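(* Let $d\in\mathbb{N}$ ($d\ge1$) and let $0<p<\infty$. Assume that $\omega:(0,1]\to(0,+\infty)$ is increasing and that $\omega(t)/t^{1-\varepsilon}$ is decreasing on $(0,1]$ for some $\varepsilon>0$. Then there exist a constant $\tau_{d,p,\omega}>0$ and functions $F_y\in\mathcal{B}^{\omega}(B_d)$, $0\le y\le1$, such that $\|F_y\|_{\mathcal{B}^{\omega}(B_d)}\le1$ for all $0\le y\le 1$ and $$\int_0^1|F_y(z)|^{2p}\,dy\ge\tau_{d,p,\omega}\,\Phi^{p}(1-|z|)$$ for all $z\in B_d$.
   Context: $B_d$ is the open unit ball of $\mathbb{C}^d$ and $H(B_d)$ is the space of holomorphic functions on $B_d$. For $f\in H(B_d)$ the radial derivative is $\mathcal{R}f(z)=\sum_{j=1}^d z_j\frac{\partial f}{\partial z_j}(z)$. The weighted Bloch space $\mathcal{B}^{\omega}(B_d)$ consists of those $f\in H(B_d)$ for which $$\|f\|_{\mathcal{B}^{\omega}(B_d)}=|f(0)|+\sup_{z\in B_d}\frac{|\mathcal{R}f(z)|(1-|z|)}{\omega(1-|z|)}<\infty.$$ The function $\Phi=\Phi_\omega$ is $$\Phi(x)=1+\int_x^1\frac{\omega^2(t)}{t}\,dt,\quad 0<x\le1$$ (so $\Phi(1)=1$), and $\Phi^p(x)=(\Phi(x))^p$. ''Increasing'' and ''decreasing'' are understood in the non-strict sense (e.g. $\omega\equiv1$ is allowed). *)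

(* Defs.v *)
From HB Require Import structures.
From mathcomp Require Import all_boot all_order all_algebra.
From mathcomp Require Import all_classical all_reals all_analysis.
From mathcomp Require Import complex.

Set Implicit Arguments.
Unset Strict Implicit.
Unset Printing Implicit Defensive.

Import Order.TTheory GRing.Theory Num.Theory.
Import numFieldNormedType.Exports.

Local Open Scope classical_set_scope.
Local Open Scope ring_scope.
Local Open Scope complex_scope.

(* R[i] is a normed module over itself, with the norm and topology that the
   library puts on R^o for every numFieldType R. *)
HB.instance Definition _ (R : realType) := GRing.ComAlgebra.copy R[i] R[i]^o.
HB.instance Definition _ (R : realType) := Vector.copy R[i] R[i]^o.
HB.instance Definition _ (R : realType) := NormedModule.copy R[i] R[i]^o.
HB.instance Definition _ (R : realType) := Num.ClosedField.on R[i].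

(* The modulus as an element of R; the norm `|z| of R[i] lives in R[i]. *)
Definition cmod (R : realType) (z : R[i]) : R := ComplexField.Normc.normc z.

(* The Euclidean norm on C^d; the library norm on 'rV is the sup norm. *)
Definition enorm (R : realType) (d : nat) (z : 'rV[R[i]]_d) : R :=
  Num.sqrt (\sum_(j < d) cmod (z 0 j) ^+ 2).

Definition unit_ball (R : realType) (d : nat) : set 'rV[R[i]]_d :=
  [set z | enorm z < 1].

(* Functions on the ball are total functions on C^d, of which only the values
   on the ball matter.  Differentiability is over the scalar field R[i], i.e.
   it is complex (Frechet) differentiability. *)
Definition holomorphic_on_ball (R : realType) (d : nat)
    (f : 'rV[R[i]]_d -> R[i]) : Prop :=
  forall z, unit_ball z -> differentiable f z.

(* 'D_(delta_mx 0 j) f z is the limit of (f (z + h e_j) - f z) / h as the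
   complex number h tends to 0, i.e. the partial derivative of f in z_j. *)
Definition radial_derivative (R : realType) (d : nat)
    (f : 'rV[R[i]]_d -> R[i]) (z : 'rV[R[i]]_d) : R[i] :=
  \sum_(j < d) z 0 j * 'D_(delta_mx 0 j) f z.

(* Takes the value +oo when the supremum is infinite. *)
Definition bloch_norm (R : realType) (d : nat) (omega : R -> R)
    (f : 'rV[R[i]]_d -> R[i]) : \bar R :=
  ((cmod (f 0))%:E +
   ereal_sup [set (cmod (radial_derivative f z) * (1 - enorm z)
                   / omega (1 - enorm z))%:E | z in @unit_ball R d])%E.

Definition weighted_bloch (R : realType) (d : nat) (omega : R -> R) :
    set ('rV[R[i]]_d -> R[i]) :=
  [set f | holomorphic_on_ball f /\ (bloch_norm omega f < +oo)%E].

Definition Phi (R : realType) (omega : R -> R) (x : R) : R :=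
  1 + \int[lebesgue_measure]_(t in `[x, 1]) (omega t ^+ 2 / t).

(* Main.v *)
Require Import Defs.
From HB Require Import structures.
From mathcomp Require Import all_boot all_order all_algebra.
From mathcomp Require Import all_classical all_reals all_analysis.
From mathcomp Require Import measurable_realfun complex.
From mathcomp Require Import ring lra.

Set Implicit Arguments.
Unset Strict Implicit.
Unset Printing Implicit Defensive.

Import Order.TTheory GRing.Theory Num.Theory.
Import numFieldNormedType.Exports.

Local Open Scope classical_set_scope.
Local Open Scope ring_scope.
Local Open Scope complex_scope.

(** The functions F_y are random power series.  Level k of the series consists
    of monomials of degree n = 2^k - 1 with weight omega(2^-k), each with its
    own Rademacher sign, a function of y.  The monomials c_alpha z^alpha are
    normalised to have maximum 1 on the unit sphere.  Such a monomial is a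
    Gaussian in disguise: its modulus at z is at most
    |z|^n exp (- |sqrt n u - sqrt alpha|^2 / 2), where u = (|z_j| / |z|)_j and
    sqrt alpha = (sqrt alpha_j)_j.  So if all exponents but one are perfect
    squares, the peaks form a unit lattice: at every z the moduli of all
    monomials of level k add up to at most a constant times |z|^n
    ([peaked_monomial_le], [level_sum_le]), and still, rounding
    sqrt n |z_j| / |z| to integers, one of them is at least a constant times
    |z|^n ([peaked_monomial_ge]).  These are the two properties for which one
    usually invokes Ryll--Wojtaszczyk polynomials.  The exceptional exponent is
    the one of the largest coordinate of z, hence there is one family for each
    coordinate.

    Upper bound.  By Euler's identity the radial derivative multiplies a monomial
    by its degree, so |R F_y(z)| is at most a constant times
    sum_k 2^k omega(2^-k) |z|^n, whatever the signs are.  The monotonicity of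
    omega and of omega(t) / t^(1 - eps) makes this sum geometric on both sides
    of 2^k = 1 / (1 - |z|), hence at most a constant times
    omega(1 - |z|) / (1 - |z|) ([derivative_series_bounded]).  The same absolute
    estimates at a slightly larger point justify termwise differentiation
    ([csum_differentiable]).

    Lower bound.  For independent signs, Khinchine's inequality
    ([khinchine_lower]) bounds the integral of |F_y(z)|^(2p) below by a constant
    times the p-th power of the sum of the squared moduli of all terms, which
    exceeds a constant times sum_k omega(2^-k)^2 |z|^(2n).  Cutting the integral
    of omega^2(t) / t at dyadic points shows that the latter sum dominates
    Phi(1 - |z|) ([Phi_le_level_sum]). *)

(** * Complex series dominated by their absolute partial sums *)

Section modulus.
Variable R : realType.
Implicit Types z w : R[i].

Lemma cmodE z : `|z| = (cmod z)%:C.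
Proof. by []. Qed.

Lemma cmod_ge0 z : 0 <= cmod z.
Proof. by case: z => a b; exact: sqrtr_ge0. Qed.

Lemma cmod0 : cmod (0 : R[i]) = 0.
Proof. exact: ComplexField.Normc.normc0. Qed.

Lemma cmod1 : cmod (1 : R[i]) = 1.
Proof. exact: ComplexField.Normc.normc1. Qed.

Lemma cmodM z w : cmod (z * w) = cmod z * cmod w.
Proof. exact: ComplexField.Normc.normcM. Qed.

Lemma cmodD z w : cmod (z + w) <= cmod z + cmod w.
Proof. exact: le_normcD. Qed.

Lemma cmodN z : cmod (- z) = cmod z.
Proof. exact: normcN. Qed.

Lemma cmodX z n : cmod (z ^+ n) = cmod z ^+ n.
Proof. by elim: n => [|n IH]; rewrite ?cmod1// !exprS cmodM IH. Qed.

Lemma cmod_sum (I : Type) (r : seq I) (P : pred I) (f : I -> R[i]) :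
  cmod (\sum_(i <- r | P i) f i) <= \sum_(i <- r | P i) cmod (f i).
Proof.
elim/big_rec2 : _ => [|i y x _ h]; first by rewrite cmod0.
exact: le_trans (cmodD _ _) (lerD _ _).
Qed.

Lemma cmod_prod (I : Type) (r : seq I) (P : pred I) (f : I -> R[i]) :
  cmod (\prod_(i <- r | P i) f i) = \prod_(i <- r | P i) cmod (f i).
Proof. exact: (big_morph _ cmodM cmod1). Qed.

Lemma cmod_real (x : R) : cmod x%:C = `|x|.
Proof. by rewrite /cmod /= expr0n addr0 sqrtr_sqr. Qed.

Lemma sqr_cmod z : cmod z ^+ 2 = complex.Re z ^+ 2 + complex.Im z ^+ 2.
Proof. by case: z => a b; rewrite sqr_sqrtr// addr_ge0// sqr_ge0. Qed.

Lemma norm_Re_cmod z : `|complex.Re z| <= cmod z.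
Proof.
by case: z => a b; rewrite -sqrtr_sqr ler_wsqrtr// lerDl sqr_ge0.
Qed.

Lemma norm_Im_cmod z : `|complex.Im z| <= cmod z.
Proof.
by case: z => a b; rewrite -sqrtr_sqr ler_wsqrtr// lerDr sqr_ge0.
Qed.

Lemma cmod_le_ReIm z : cmod z <= `|complex.Re z| + `|complex.Im z|.
Proof.
rewrite -(ler_pXn2r (_ : 0 < 2)%N) ?nnegrE ?cmod_ge0 ?addr_ge0//.
by rewrite sqr_cmod sqrrD !real_normK ?num_real// -addrA lerD2l lerDr
  mulrn_wge0// mulr_ge0.
Qed.

End modulus.

Section csum.
Variable R : realType.
Implicit Types u v : nat -> R[i].

(** Summing real and imaginary parts separately reduces convergence to the
    completeness of the real line. *)
Definition csum u : R[i] :=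
  limn (series (fun a => complex.Re (u a))) +i* limn (series (fun a => complex.Im (u a))).

(** Absolute summability, stated with an explicit bound so that the estimates
    below carry their constants along. *)
Definition abs_bounded u (B : R) :=
  forall N, \sum_(0 <= a < N) cmod (u a) <= B.

Lemma abs_bounded_le u v B : (forall a, cmod (u a) <= cmod (v a)) ->
  abs_bounded v B -> abs_bounded u B.
Proof. by move=> h hv N; apply: le_trans (hv N); apply: ler_sum. Qed.

Lemma cvg_series_dominated (f : R^nat) u B : (forall a, `|f a| <= cmod (u a)) ->
  abs_bounded u B -> cvgn (series f).
Proof.
move=> h hu; apply: normed_cvg; apply: nondecreasing_is_cvgn.
  by apply: nondecreasing_series => n _ _; exact: normr_ge0.
exists B => _ [N _ <-]; apply: le_trans (hu N).
by rewrite /= /series /=; apply: ler_sum.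
Qed.

Lemma cvg_series_Re u B : abs_bounded u B ->
  cvgn (series (fun a => complex.Re (u a))).
Proof. by apply: cvg_series_dominated => a; exact: norm_Re_cmod. Qed.

Lemma cvg_series_Im u B : abs_bounded u B ->
  cvgn (series (fun a => complex.Im (u a))).
Proof. by apply: cvg_series_dominated => a; exact: norm_Im_cmod. Qed.

(** The factor 2 is the price of bounding the two real series separately; it
    is absorbed by the final normalisation. *)
Lemma cmod_csum_le u B : abs_bounded u B -> cmod (csum u) <= 2 * B.
Proof.
move=> hu; apply: le_trans (cmod_le_ReIm _) _.
rewrite mulr_natl mulr2n /=.
suff H (f : R^nat) : (forall a, `|f a| <= cmod (u a)) -> cvgn (series f) ->
    `|limn (series f)| <= B.
  apply: lerD; apply: H => [a|].
  - exact: norm_Re_cmod.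
  - exact: cvg_series_Re hu.
  - exact: norm_Im_cmod.
  - exact: cvg_series_Im hu.
move=> h cf; rewrite -lim_norm//; apply: limr_le.
  exact: is_cvg_norm.
near=> N; apply: le_trans (hu N).
by apply: le_trans (ler_norm_sum _ _ _) _; apply: ler_sum.
Unshelve. all: by end_near. Qed.

Lemma csumD u v B C : abs_bounded u B -> abs_bounded v C ->
  csum (fun a => u a + v a) = csum u + csum v.
Proof.
move=> hu hv; rewrite /csum; apply/eqP; rewrite eq_complex/=; apply/andP; split.
- rewrite -(lim_seriesD (cvg_series_Re hu) (cvg_series_Re hv)).
  by apply/eqP; congr (limn (series _)); apply/funext => a /=; rewrite raddfD.
- rewrite -(lim_seriesD (cvg_series_Im hu) (cvg_series_Im hv)).
  by apply/eqP; congr (limn (series _)); apply/funext => a /=; rewrite raddfD.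
Qed.


Lemma abs_boundedZ (c : R[i]) u B : abs_bounded u B ->
  abs_bounded (fun a => c * u a) (cmod c * B).
Proof.
move=> hu N; under eq_bigr do rewrite cmodM.
by rewrite -big_distrr/= ler_wpM2l ?cmod_ge0.
Qed.

Lemma csumZ (c : R[i]) u B : abs_bounded u B ->
  csum (fun a => c * u a) = c * csum u.
Proof.
move=> hu; have cR := cvg_series_Re hu; have cI := cvg_series_Im hu.
have limZ (k : R) (f : R^nat) (cf : cvgn (series f)) :
  limn (series (k *: f)) = k * limn (series f) := lim_seriesZ k cf.
case: c => a b; rewrite /csum; apply/eqP; rewrite eq_complex/=; apply/andP; split.
- have E := lim_seriesB (is_cvg_seriesZ (k := a) cR) (is_cvg_seriesZ (k := b) cI).
  rewrite !limZ// in E; apply/eqP; apply: etrans E.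
  have ReM w : complex.Re ((a +i* b) * w) = a * complex.Re w - b * complex.Im w.
    by case: w.
  by congr (limn (series _)); apply/funext => k; exact: ReM.
- have E := lim_seriesD (is_cvg_seriesZ (k := a) cI) (is_cvg_seriesZ (k := b) cR).
  rewrite !limZ// in E; apply/eqP; apply: etrans E.
  have ImM w : complex.Im ((a +i* b) * w) = a * complex.Im w + b * complex.Re w.
    by case: w.
  by congr (limn (series _)); apply/funext => k; exact: ImM.
Qed.

Lemma abs_boundedD u v B C : abs_bounded u B -> abs_bounded v C ->
  abs_bounded (fun a => u a + v a) (B + C).
Proof.
move=> hu hv N; apply: le_trans (lerD (hu N) (hv N)).
by rewrite -big_split; apply: ler_sum => a _; exact: cmodD.
Qed.

Lemma abs_bounded_sum (I : Type) (r : seq I) (u_ : I -> nat -> R[i]) (B : I -> R) :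
  (forall i, abs_bounded (u_ i) (B i)) ->
  abs_bounded (fun a => \sum_(i <- r) u_ i a) (\sum_(i <- r) B i).
Proof.
move=> h; elim: r => [|i r IH].
  by move=> N; rewrite big_nil big1// => a _; rewrite big_nil cmod0.
rewrite big_cons; under [X in abs_bounded X]eq_fun do rewrite big_cons.
exact: abs_boundedD.
Qed.

Lemma csum0 : csum (fun=> 0) = 0.
Proof.
have h : abs_bounded (fun=> 0) 0 by move=> N; rewrite big1// => a _; exact: cmod0.
rewrite -[RHS](mul0r (csum (fun=> 0))) -(csumZ 0 h).
by congr csum; apply/funext => a; rewrite mul0r.
Qed.

Lemma csum_sum (I : Type) (r : seq I) (u_ : I -> nat -> R[i]) (B : I -> R) :
  (forall i, abs_bounded (u_ i) (B i)) ->
  csum (fun a => \sum_(i <- r) u_ i a) = \sum_(i <- r) csum (u_ i).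
Proof.
move=> h; elim: r => [|i r IH].
  by under [X in csum X]eq_fun do rewrite big_nil; rewrite csum0 big_nil.
under [X in csum X]eq_fun do rewrite big_cons.
by rewrite (csumD (h i) (abs_bounded_sum r h)) IH big_cons.
Qed.

Lemma csum_finite u N : (forall a, (N <= a)%N -> u a = 0) ->
  csum u = \sum_(0 <= a < N) u a.
Proof.
move=> h; have H (f : R[i] -> R) : f 0 = 0 ->
    limn (series (fun a => f (u a))) = \sum_(0 <= a < N) f (u a).
  move=> f0; apply/cvg_lim => //; apply: cvg_near_cst; near=> M.
  have NM : (N <= M)%N by near: M; exact: nbhs_infty_ge.
  rewrite /series/= (big_cat_nat (n := N))//= [X in _ + X]big_nat_cond.
  rewrite [X in _ + X]big1 ?addr0// => a /andP[/andP[Na _] _].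
  by rewrite h.
by apply/eqP; rewrite /csum !H// eq_complex /= !raddf_sum !eqxx.
Unshelve. all: by end_near. Qed.

(** The tail of u serves for all v with smaller terms at once; this makes the
    truncation below independent of the signs. *)
Lemma csum_approx u B delta : abs_bounded u B -> 0 < delta ->
  exists N0, forall N, (N0 <= N)%N -> forall v,
    (forall a, cmod (v a) <= cmod (u a)) ->
    cmod (csum v - \sum_(0 <= a < N) v a) <= delta.
Proof.
move=> hu d0.
have cu : cvgn (series (fun a => cmod (u a))).
  apply: (@cvg_series_dominated _ u B) => // a.
  by rewrite ger0_norm ?cmod_ge0.
have d20 : 0 < delta / 2 by lra.
have /cvgrPdist_le/(_ _ d20)[N0 _ hN0] := cu.
exists N0 => N NN0 v hv.
have tailb : abs_bounded (fun a => if (a < N)%N then 0 else v a) (delta / 2).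
  move=> M; have [MN|NM] := leqP M N.
    rewrite big_nat_cond big1 ?ltW// => a /andP[/andP[_ aM] _].
    by rewrite (leq_trans aM MN) cmod0.
  rewrite (big_cat_nat (n := N))//=; last exact: ltnW.
  rewrite [X in X + _]big_nat_cond big1 ?add0r; last first.
    by move=> a /andP[/andP[_ ->] _]; rewrite cmod0.
  apply: (@le_trans _ _ (\sum_(N <= a < M) cmod (u a))).
    apply: ler_sum_nat => a /andP[Na _].
    by rewrite ltnNge Na; exact: hv.
  have := hN0 N NN0; rewrite /= ler_norml => /andP[_]; apply: le_trans.
  rewrite lerBrDl -(big_cat_nat (n := N))//=; last exact: ltnW.
  apply: nondecreasing_cvgn_le => //.
  by apply: nondecreasing_series => a _ _; exact: cmod_ge0.
have vE : v = fun a => (if (a < N)%N then v a else 0) +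
                       (if (a < N)%N then 0 else v a).
  by apply/funext => a; case: ifP; rewrite ?addr0 ?add0r.
have headb : abs_bounded (fun a => if (a < N)%N then v a else 0) B.
  apply: (abs_bounded_le _ hu) => a; case: ifP => _ //.
  by rewrite cmod0 cmod_ge0.
rewrite {1}vE (csumD headb tailb) (csum_finite (N := N)); last first.
  by move=> a; rewrite leqNgt => /negbTE ->.
rewrite big_nat_cond [X in _ - X]big_nat_cond.
rewrite (eq_bigr v) => [|a /andP[/andP[_ ->]]//].
rewrite addrAC subrr add0r.
by apply: le_trans (cmod_csum_le tailb) _; lra.
Qed.

End csum.

(** * Rademacher signs and their second and fourth moments *)

Section rademacher.
Variable R : realType.
Implicit Types (y : R) (u : nat -> R[i]).

(** The parity of the integer part of 2^(a+1) y is the binary digit of y of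
    index a, so these signs are the Rademacher functions, independent for y
    uniform in [0, 1]. *)
Definition rad (a : nat) y : R := (-1) ^+ Num.truncn (2 ^+ a.+1 * y).

Lemma norm_rad a y : `|rad a y| = 1.
Proof. by rewrite /rad normrX normrN1 expr1n. Qed.

Lemma truncn_half y : 0 <= y -> Num.truncn y = (Num.truncn (2 * y))./2.
Proof.
move=> y0; have y20 : 0 <= 2 * y by lra.
have /andP[h1 h2] := truncn_itv y20.
apply: truncn_def; move: h1 h2; set n := Num.truncn _ => h1 h2.
have E : n%:R = (odd n)%:R + 2 * (n./2)%:R :> R.
  by rewrite -{1}(odd_double_half n) natrD -mul2n natrM.
have : (odd n)%:R <= 1 :> R by case: (odd n).
have : 0 <= (odd n)%:R :> R by case: (odd n).
by rewrite -!natr1 in h2 *; move=> ? ?; apply/andP; split; lra.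
Qed.

(** A binary digit is an affine combination of two integer parts, each of
    which is monotone in y. *)
Lemma measurable_rad a : measurable_fun (`[0%R, 1%R] : set R) (rad a).
Proof.
pose t b : R -> R := fun y => (Num.truncn (2 ^+ b * y))%:R.
have mt b : measurable_fun (`[0%R, 1%R] : set R) (t b).
  apply: nondecreasing_measurable => // r s rs.
  by rewrite /t ler_nat le_truncn// ler_wpM2l// exprn_ge0.
apply: (@eq_measurable_fun _ _ _ _ _ (fun y => 1 - 2 * (t a.+1 y - 2 * t a y))).
  move=> y; rewrite inE/= in_itv/= => /andP[y0 _].
  have E : t a y = ((Num.truncn (2 ^+ a.+1 * y))./2)%:R.
    by rewrite /t truncn_half ?mulr_ge0 ?exprn_ge0// mulrA -exprS.
  rewrite E /rad /t; set n := Num.truncn _.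
  rewrite -signr_odd -[in X in _ - 2 * (X - _)](odd_double_half n) natrD -mul2n natrM.
  by case: (odd n) => /=; ring.
apply: measurable_funB; first exact: measurable_cst.
apply: measurable_funM; first exact: measurable_cst.
apply: measurable_funB; first exact: mt.
by apply: measurable_funM; [exact: measurable_cst|exact: mt].
Qed.

(** The partial sum of signed terms over a dyadic interval of length 2^-N only
    depends on the index j of the interval; halving j drops the last digit.
    Integrals over [0, 1] thus become averages over j < 2^N. *)
Fixpoint walk u N j : R[i] :=
  if N is N'.+1 then walk u N' j./2 + (-1) ^+ j * u N' else 0.

Lemma sum_rad u N y : 0 <= y ->
  \sum_(0 <= a < N) (rad a y)%:C * u a = walk u N (Num.truncn (2 ^+ N * y)).
Proof.
move=> y0; elim: N => [|N IH]; first by rewrite big_geq.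
rewrite big_nat_recr//= IH; congr (walk u N _ + _).
  by rewrite truncn_half ?mulr_ge0 ?exprn_ge0// mulrA -exprS.
by rewrite /rad rmorphXn rmorphN1.
Qed.

Lemma sum_dyadic (f : nat -> R) N :
  \sum_(0 <= j < 2 ^ N.+1) f j = \sum_(0 <= j < 2 ^ N) (f j.*2 + f j.*2.+1).
Proof.
rewrite expnS mul2n; elim: (2 ^ N)%N => [|M IH]; first by rewrite !big_geq.
by rewrite doubleS !big_nat_recr//= IH addrA.
Qed.

Lemma walk_children u N j :
  walk u N.+1 j.*2 = walk u N j + u N /\ walk u N.+1 j.*2.+1 = walk u N j - u N.
Proof.
rewrite /= !doubleK uphalf_double; split.
  by rewrite -signr_odd odd_double mul1r.
by rewrite -signr_odd /= odd_double /= mulN1r.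
Qed.

Lemma cmod_parallelogram (z w : R[i]) :
  cmod (z + w) ^+ 2 + cmod (z - w) ^+ 2 = 2 * (cmod z ^+ 2 + cmod w ^+ 2).
Proof.
by rewrite !sqr_cmod; case: z w => [a b] [c d] /=; ring.
Qed.

Lemma cmod_parallelogram4 (z w : R[i]) :
  cmod (z + w) ^+ 4 + cmod (z - w) ^+ 4 <=
  2 * (cmod z ^+ 4 + 6 * cmod z ^+ 2 * cmod w ^+ 2 + cmod w ^+ 4).
Proof.
rewrite (exprM _ 2 2) (exprM (cmod (z - w)) 2 2).
rewrite (exprM (cmod z) 2 2) (exprM (cmod w) 2 2).
rewrite !sqr_cmod; case: z w => [a b] [c d] /=.
have := sqr_ge0 (a * d - b * c); lra.
Qed.

Lemma walk_moment2 u N : \sum_(0 <= j < 2 ^ N) cmod (walk u N j) ^+ 2 =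
  2 ^+ N * \sum_(0 <= a < N) cmod (u a) ^+ 2.
Proof.
elim: N => [|N IH]; first by rewrite big_nat1 big_geq// cmod0 expr0n mulr0.
rewrite sum_dyadic big_nat_recr//=.
under eq_bigr => j _.
  have [E1 E2] := walk_children u N j.
  rewrite /= in E1 E2; rewrite E1 E2 cmod_parallelogram; over.
rewrite -big_distrr/= big_split/= IH sumr_const_nat subn0.
by rewrite -[_ ^+ 2 *+ _]mulr_natl natrX [2 ^+ N.+1]exprS; ring.
Qed.

(** By induction on the number of terms, with the parallelogram bound for
    fourth powers: if s is the second moment so far and t the square of the
    new term, then 3 s^2 + 6 s t + t^2 <= 3 (s + t)^2. *)
Lemma walk_moment4 u N : \sum_(0 <= j < 2 ^ N) cmod (walk u N j) ^+ 4 <=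
  3 * 2 ^+ N * (\sum_(0 <= a < N) cmod (u a) ^+ 2) ^+ 2.
Proof.
elim: N => [|N IH]; first by rewrite big_nat1 big_geq// cmod0 !expr0n mulr0.
rewrite sum_dyadic big_nat_recr//=.
set s := \sum_(0 <= a < N) _ in IH *; set v := cmod (u N).
apply: (@le_trans _ _ (\sum_(0 <= j < 2 ^ N) 2 * (cmod (walk u N j) ^+ 4 +
    6 * cmod (walk u N j) ^+ 2 * v ^+ 2 + v ^+ 4))).
  apply: ler_sum => j _; have [E1 E2] := walk_children u N j.
  by rewrite /= in E1 E2; rewrite E1 E2; exact: cmod_parallelogram4.
rewrite -big_distrr/= !big_split/= -big_distrl/= -big_distrr/= walk_moment2 -/s.
rewrite sumr_const_nat subn0 -[v ^+ 4 *+ _]mulr_natl natrX [2 ^+ N.+1]exprS.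
have P : 0 <= 2 ^+ N * v ^+ 4 :> R by rewrite mulr_ge0 ?exprn_ge0 ?cmod_ge0.
move: IH P; set m := \sum_(_ <= _ < _) _; set q := 2 ^+ N.
rewrite (exprM v 2 2); move: (v ^+ 2) => w; lra.
Qed.

(** Paley--Zygmund: the fourth moment prevents the second moment from sitting
    on a small set of sign patterns, so a fixed fraction of the patterns is
    large.  This is what makes the lower bound available for small exponents
    as well as large ones. *)
Lemma walk_large u N (S : R) : 0 < S -> S <= \sum_(0 <= a < N) cmod (u a) ^+ 2 ->
  (2 ^+ N / 12 : R) <= \sum_(0 <= j < 2 ^ N) (S / 2 <= cmod (walk u N j) ^+ 2)%R%:R.
Proof.
move=> S0; set s := \sum_(0 <= a < N) _ => Ss.
have s0 : 0 < s by exact: lt_le_trans Ss.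
have s0' := ltW s0.
(* The indicator dominates a concave parabola in t = |walk|^2, chosen such that
   the moments of t make the average of the parabola at least s / 4. *)
have pt j : cmod (walk u N j) ^+ 2 - s / 2 - cmod (walk u N j) ^+ 4 / (12 * s) <=
    3 * s * (S / 2 <= cmod (walk u N j) ^+ 2)%R%:R.
  rewrite (exprM _ 2 2); move: (cmod _ ^+ 2) (sqr_ge0 (cmod (walk u N j))) => t t0.
  have [h|h] := lerP (S / 2) t.
    rewrite /= mulr1n mulr1 -subr_ge0.
    have -> : 3 * s - (t - s / 2 - t ^+ 2 / (12 * s)) =
      (t / 6 - s) ^+ 2 * (3 / s) + s / 2 by field; rewrite gt_eqF.
    apply: addr_ge0; last by lra.
    by apply: mulr_ge0; [exact: sqr_ge0|exact: divr_ge0].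
  rewrite /= mulr0n mulr0; have : 0 <= t ^+ 2 / (12 * s).
    by apply: divr_ge0; [exact: sqr_ge0|exact: mulr_ge0].
  by lra.
have : \sum_(0 <= j < 2 ^ N) (cmod (walk u N j) ^+ 2 - s / 2 -
    cmod (walk u N j) ^+ 4 / (12 * s)) <=
  \sum_(0 <= j < 2 ^ N) 3 * s * (S / 2 <= cmod (walk u N j) ^+ 2)%R%:R.
  by apply: ler_sum => j _; exact: pt.
rewrite -big_distrr/= !big_split/= !sumrN -big_distrl/= walk_moment2 -/s.
rewrite sumr_const_nat subn0 -big_distrl/= -[s *+ _]mulr_natl natrX.
move=> H; rewrite -(ler_pM2l (_ : 0 < 3 * s)); last by lra.
apply: le_trans H.
have : (\sum_(0 <= j < 2 ^ N) cmod (walk u N j) ^+ 4) / (12 * s) <= 2 ^+ N * s / 4.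
  rewrite ler_pdivrMr; last by lra.
  by apply: le_trans (walk_moment4 u N) _; rewrite -/s; lra.
set X := _ / (12 * s); lra.
Qed.

End rademacher.

(** * The lower Khinchine inequality for every exponent *)

Section khinchine.
Variable R : realType.
Implicit Types (y : R) (u : nat -> R[i]).
Local Notation mu := (@lebesgue_measure R).

Lemma integral_ge_dyadic (f : R -> R) (l : nat -> R) N :
  measurable_fun (`[0%R, 1%R] : set R) f -> (forall y, 0 <= f y) ->
  (forall j, 0 <= l j) ->
  (forall y, 0 <= y <= 1 -> l (Num.truncn (2 ^+ N * y)) <= f y) ->
  ((\sum_(0 <= j < 2 ^ N) l j / 2 ^+ N)%:E <=
    \int[mu]_(y in `[0%R, 1%R]) (f y)%:E)%E.
Proof.
move=> mf f0 l0 lf; pose h : R := (2 ^+ N)^-1.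
have q0 : 0 < 2 ^+ N :> R by rewrite exprn_gt0.
have h0 : 0 < h by rewrite invr_gt0.
have hM M : (M <= 2 ^ N)%N -> M%:R * h <= 1.
  by move=> MN; rewrite ler_pdivrMr// mul1r -natrX ler_nat.
have mfS (D : set R) : measurable D -> D `<=` `[0%R, 1%R] ->
    measurable_fun D (fun y => (f y)%:E).
  by move=> mD DS; apply/measurable_EFinP; apply: measurable_funS mf.
have step M : (M <= 2 ^ N)%N -> ((\sum_(0 <= j < M) l j / 2 ^+ N)%:E <=
    \int[mu]_(y in `[0%R, (M%:R * h)%R[) (f y)%:E)%E.
  elim: M => [|M IH] ltM.
    by rewrite big_geq// integral_ge0// => y _; rewrite lee_fin.
  have leM := hM _ ltM.
  have MM : M%:R * h <= M.+1%:R * h by rewrite ler_pM2r// ler_nat.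
  have M0 : 0 <= M%:R * h by rewrite mulr_ge0// ltW.
  have E : `[0%R, (M.+1%:R * h)%R[%classic =
      `[0%R, (M%:R * h)%R[%classic `|` `[(M%:R * h)%R, (M.+1%:R * h)%R[%classic.
    by rewrite -itv_bndbnd_setU// bnd_simp.
  rewrite E ge0_integral_setU//=; last 3 first.
  - rewrite -E; apply: mfS => // y /=; rewrite !in_itv/= => /andP[-> y1] /=.
    exact: le_trans (ltW y1) leM.
  - by move=> y _; rewrite lee_fin.
  - apply/disj_setPS => y [] /=; rewrite !in_itv/= => /andP[_ h1] /andP[h2 _].
    by rewrite (lt_geF h1) in h2.
  rewrite big_nat_recr//= EFinD; apply: leeD; first by apply: IH; exact: ltnW.
  have -> : (l M / 2 ^+ N)%:E =
      (\int[mu]_(y in `[(M%:R * h)%R, (M.+1%:R * h)%R[) cst (l M)%:E y)%E.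
    rewrite integral_cst//= lebesgue_measure_itv/= lte_fin ltr_pM2r// ltr_nat.
    rewrite ltnSn -EFinB -EFinM; congr (_ * _)%:E.
    by rewrite -mulrBl -[M.+1%:R]natr1 addrAC subrr add0r mul1r.
  apply: ge0_le_integral => //=.
  - by move=> y _; rewrite lee_fin.
  - apply: mfS => // y /=; rewrite !in_itv/= => /andP[y0 y1].
    by rewrite (le_trans M0 y0) (le_trans (ltW y1)).
  - move=> y; rewrite in_itv/= => /andP[y0 y1]; rewrite lee_fin.
    have yy : 0 <= y <= 1 by rewrite (le_trans M0 y0) (le_trans (ltW y1)).
    have := lf _ yy; congr (l _ <= _); apply: truncn_def.
    by rewrite mulrC -ler_pdivrMr// -ltr_pdivlMr// y0 y1.
apply: le_trans (step _ (leqnn _)) _; apply: ge0_subset_integral => //=.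
- exact: mfS.
- by move=> y _; rewrite lee_fin.
- move=> y /=; rewrite !in_itv/= => /andP[-> y1] /=.
  exact: le_trans (ltW y1) (hM _ (leqnn _)).
Qed.

Definition rsum u y := csum (fun a => (rad a y)%:C * u a).

Lemma cmod_rad a y (z : R[i]) : cmod ((rad a y)%:C * z) = cmod z.
Proof. by rewrite cmodM cmod_real norm_rad mul1r. Qed.

Lemma measurable_rsum u B (p : R) : abs_bounded u B ->
  measurable_fun (`[0%R, 1%R] : set R) (fun y => cmod (rsum u y) `^ p).
Proof.
move=> hu; have hb y : abs_bounded (fun a => (rad a y)%:C * u a) B.
  by apply: abs_bounded_le hu => a; rewrite cmod_rad.
have mlim (g : R[i] -> R) : (forall a y, g ((rad a y)%:C * u a) = rad a y * g (u a)) ->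
    (forall y, cvgn (series (fun a => g ((rad a y)%:C * u a)))) ->
    measurable_fun (`[0%R, 1%R] : set R)
      (fun y => limn (series (fun a => g ((rad a y)%:C * u a)))).
  move=> gE gc; apply: (@measurable_fun_cvg _ _ _ _
    (fun N y => series (fun a => g ((rad a y)%:C * u a)) N)); last first.
    by move=> y _; exact: gc.
  move=> N; rewrite /series/=; apply: measurable_sum => a.
  apply: (eq_measurable_fun (fun y => rad a y * g (u a))) => [y _|].
    by rewrite -gE.
  by apply: measurable_funM; [exact: measurable_rad|exact: measurable_cst].
have mRe := mlim (@complex.Re R).
have mIm := mlim (@complex.Im R).
apply: (@measurableT_comp _ _ _ _ _ _ (fun x => x `^ p)).
  exact: measurable_powR.
rewrite /cmod /rsum /csum /=.
apply: (@measurableT_comp _ _ _ _ _ _ (@Num.sqrt R)).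
  by apply: continuous_measurable_fun; exact: sqrt_continuous.
apply: measurable_funD; apply: measurable_funX.
- apply: mRe => [a y|y]; last exact: cvg_series_Re (hb y).
  by case: (u a) => x1 x2 /=; rewrite mul0r subr0.
- apply: mIm => [a y|y]; last exact: cvg_series_Im (hb y).
  by case: (u a) => x1 x2 /=; rewrite mul0r addr0.
Qed.

(** On at least one twelfth of [0, 1] the partial sum is at least a fixed
    fraction of its quadratic mean, and truncating far enough makes the tail
    negligible there. *)
Lemma khinchine_lower u B (p S : R) N0 : abs_bounded u B -> 0 < p -> 0 < S ->
  S <= \sum_(0 <= a < N0) cmod (u a) ^+ 2 ->
  (((S / 16) `^ p / 12)%:E <=
    \int[mu]_(y in `[0%R, 1%R]) (cmod (rsum u y) `^ (2 * p))%:E)%E.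
Proof.
move=> hu p0 S0 hS; pose T := Num.sqrt S.
have T0 : 0 < T by rewrite sqrtr_gt0.
have TS : T ^+ 2 = S by rewrite sqr_sqrtr// ltW.
have T40 : 0 < T / 4 by lra.
have [N1 hN1] := csum_approx hu T40.
pose N := maxn N0 N1.
have hSN : S <= \sum_(0 <= a < N) cmod (u a) ^+ 2.
  apply: le_trans hS _; rewrite [leRHS](big_cat_nat (n := N0))//= ?leq_maxl//.
  by rewrite lerDl sumr_ge0// => a _; rewrite exprn_ge0 ?cmod_ge0.
pose c := (S / 16) `^ p.
have := @integral_ge_dyadic (fun y => cmod (rsum u y) `^ (2 * p))
  (fun j => c * (S / 2 <= cmod (walk u N j) ^+ 2)%R%:R) N
  (measurable_rsum _ hu).
move=> /(_ (fun y => powR_ge0 _ _)) /(_ (fun j => mulr_ge0 (powR_ge0 _ _) (ler0n _ _))).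
move=> H; apply: le_trans (H _).
  rewrite lee_fin -big_distrl/= -big_distrr/= -mulrA ler_wpM2l ?powR_ge0//.
  rewrite ler_pdivlMr ?exprn_gt0// mulrC.
  exact: walk_large.
move=> y /andP[y0 y1]; have [h|h] := lerP (S / 2) (cmod (walk u N _) ^+ 2); last first.
  by rewrite mulr0n mulr0 powR_ge0.
rewrite mulr1n mulr1 /c powRrM powR_mulrn ?cmod_ge0//.
apply: ge0_ler_powR; rewrite ?nnegrE ?exprn_ge0 ?cmod_ge0 ?(ltW p0)//; first by lra.
have := hN1 N (leq_maxr _ _) (fun a => (rad a y)%:C * u a).
have le_rad a : cmod ((rad a y)%:C * u a) <= cmod (u a) by rewrite cmod_rad.
move=> /(_ le_rad).
rewrite sum_rad// -/(rsum u y); set X := walk _ _ _ in h * => hX.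
have hT : T / 2 <= cmod X.
  rewrite -(ler_pXn2r (_ : 0 < 2)%N) ?nnegrE ?cmod_ge0 ?divr_ge0 ?(ltW T0)//.
  by rewrite expr_div_n TS; lra.
have hr : T / 4 <= cmod (rsum u y).
  have := cmodD (rsum u y) (X - rsum u y); rewrite addrC subrK.
  by rewrite -[cmod (X - _)]cmodN opprB; lra.
have -> : S / 16 = (T / 4) ^+ 2 by rewrite expr_div_n TS; congr (_ / _); ring.
by rewrite ler_pXn2r ?nnegrE ?cmod_ge0 ?(ltW T40).
Qed.

End khinchine.

(** * Complex derivatives from quadratic remainders *)

Lemma norm_entry_le (K : numFieldType) m n (A : 'M[K]_(m, n)) (p : 'I_m * 'I_n) :
  `|A p.1 p.2| <= `|A|.
Proof.
rewrite [leRHS]/Num.norm /= mx_normE -[leLHS]nngE num_le; exact: le_bigmax.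
Qed.

Section complex_derivative.
Variables (R : realType) (d : nat).
Local Notation C := R[i].
Implicit Types (f g : 'rV[C]_d -> C) (z h : 'rV[C]_d) (D : 'I_d -> C).

Lemma cmod_coord_le h (j : 'I_d) : (cmod (h 0 j))%:C <= `|h|.
Proof. exact: (norm_entry_le h (0, j)). Qed.

Lemma linear_form_continuous D : continuous (fun h => \sum_j D j * h 0 j : C).
Proof.
elim: (index_enum _) => [|j s IH].
  rewrite (_ : (fun _ => _) = cst 0); first exact: cst_continuous.
  by apply/funext => h; rewrite big_nil.
rewrite (_ : (fun _ => _) =
    (fun h => D j * h 0 j) \+ (fun h => \sum_(j <- s) D j * h 0 j)); last first.
  by apply/funext => h; rewrite big_cons.
move=> h; have hj : (fun h => D j * h 0 j) @ h --> (D j * h 0 j : C).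
  have h1 : (fun=> D j) @ h --> (D j : C). apply: cst_continuous.
  have h2 : (fun h : 'rV[C]_d => h 0 j) @ h --> (h 0 j : C).
    exact: coord_continuous.
  exact: cvgM h1 h2.
exact: cvgD hj (IH h).
Qed.

(** A remainder that is quadratic on a polydisc determines the Frechet
    derivative; the parameter s is the size of h relative to the radius rho. *)
Lemma differentiable_quadratic f z D (rho M : R) : 0 < rho ->
  (forall h s, 0 <= s <= 1 -> (forall j, cmod (h 0 j) <= s * rho) ->
    cmod (f (z + h) - f z - \sum_j D j * h 0 j) <= s ^+ 2 * M) ->
  differentiable f z /\ forall v, 'D_v f z = \sum_j D j * v 0 j.
Proof.
move=> rho0 hf; pose L h := \sum_j D j * h 0 j : C.
have Llin : linear L.
  move=> a u v; rewrite /L scaler_sumr -big_split/=; apply: eq_bigr => j _.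
  by rewrite !mxE mulrDr; congr (_ + _); rewrite mulrCA.
pose LM := GRing.isLinear.Build _ _ _ _ L Llin.
pose L' : {linear 'rV[C]_d -> C} := HB.pack L LM.
have Lcont : continuous L' by exact: linear_form_continuous.
have fL : f \o shift z = cst (f z) + L' +o_ (0 : 'rV[C]_d) id.
  apply/eqaddoP => eps eps0.
  have epsE : eps = (complex.Re eps)%:C.
    by apply/eqP; rewrite eq_complex /= eqxx /= -(ger0_Im (ltW eps0)).
  have e0 : 0 < complex.Re eps by rewrite -ltcR -epsE.
  have M0 : 0 < `|M| + 1 by rewrite ltr_wpDl.
  (* Below t0 the quadratic remainder is at most eps times the norm of h. *)
  pose t0 := Num.min rho (complex.Re eps * rho ^+ 2 / (`|M| + 1)).
  have t00 : 0 < t0 by rewrite lt_min rho0 divr_gt0 ?mulr_gt0 ?exprn_gt0.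
  have t0C : 0 < t0%:C :> C by rewrite ltcR.
  near=> h.
  have hn : `|h| < t0%:C by near: h; exact: (@pseudometric_normed_Zmodule.nbhs0_lt C 'rV[C]_d).
  pose t := complex.Re `|h|.
  have hE : `|h| = t%:C.
    apply/eqP; rewrite eq_complex /= eqxx /= -(ger0_Im (normr_ge0 h)) //.
  have tt : 0 <= t by rewrite -lecR -hE normr_ge0.
  have tt0 : t < t0 by rewrite -ltcR -hE.
  have hs : 0 <= t / rho <= 1.
    rewrite divr_ge0 ?(ltW rho0)//= ler_pdivrMr// mul1r ltW//.
    by apply: lt_le_trans tt0 _; rewrite ge_min lexx.
  have hj j : cmod (h 0 j) <= t / rho * rho.
    by rewrite divfK ?gt_eqF// -lecR -hE cmod_coord_le.
  rewrite -[_ h]/(f (h + z) - (f z + L h)) [h + z]addrC opprD addrA cmodE epsE hE -rmorphM lecR.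
  apply: le_trans (hf h _ hs hj) _.
  have tM : t * (`|M| + 1) <= complex.Re eps * rho ^+ 2.
    rewrite -ler_pdivlMr//; apply: le_trans (ltW tt0) _.
    by rewrite ge_min lexx orbT.
  rewrite expr_div_n mulrAC ler_pdivrMr ?exprn_gt0//.
  apply: (@le_trans _ _ (t * (t * (`|M| + 1)))); last first.
    by rewrite [leRHS]mulrAC [leRHS]mulrC ler_wpM2l.
  rewrite expr2 -mulrA ler_wpM2l// ler_wpM2l//.
  by apply: le_trans (ler_norm M) _; rewrite lerDl.
have dE : 'd f z = L' :> (_ -> _) by exact: diff_unique fL.
have df : differentiable f z by apply/diff_locallyP; rewrite dE.
by split=> // v; rewrite deriveE// dE.
Unshelve. all: by end_near. Qed.

End complex_derivative.

(** * Termwise differentiation of series of monomials *)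

Section taylor.
Variables (R : realType) (d : nat).
Local Notation C := R[i].
Implicit Types (f g : 'rV[C]_d -> C) (z h : 'rV[C]_d) (D : 'I_d -> C).

(** A first-order expansion on a polydisc of radius rho with gradient D, whose
    value, derivative and remainder have majorants of total M.  Such majorants
    multiply, so a monomial is majorised by its value at the point
    (|z_j| + rho)_j; this is Cauchy's estimate without integration.  The last
    clause is Euler's identity for homogeneity of degree n. *)
Definition taylor_at (rho : R) z f (n : nat) (M : R) D :=
  exists M0 M1 M2 : R, [/\ 0 <= M1, 0 <= M2 & M0 + M1 + M2 <= M] /\
  [/\ cmod (f z) <= M0, \sum_j cmod (D j) * rho <= M1,
    forall h s, 0 <= s <= 1 -> (forall j, cmod (h 0 j) <= s * rho) ->
      cmod (f (z + h) - f z - \sum_j D j * h 0 j) <= s ^+ 2 * M2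
    & \sum_j z 0 j * D j = n%:R * f z].

Lemma taylor_cst rho z (c : C) : exists D, taylor_at rho z (fun=> c) 0 (cmod c) D.
Proof.
exists (fun=> 0), (cmod c), 0, 0; split; first by rewrite !addr0.
split=> // [|h s _ _|].
- by rewrite big1// => j _; rewrite cmod0 mul0r.
- rewrite big1 => [|j _]; last by rewrite mul0r.
  by rewrite subrr subr0 cmod0 mulr0.
- by rewrite mul0r big1// => j _; rewrite mulr0.
Qed.

Lemma taylor_coord rho z (j : 'I_d) : 0 <= rho ->
  exists D, taylor_at rho z (fun z => z 0 j) 1 (cmod (z 0 j) + rho) D.
Proof.
move=> rho0; exists (fun i => (i == j)%:R), (cmod (z 0 j)), rho, 0.
have delta (F : 'I_d -> C) : \sum_i (i == j)%:R * F i = F j.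
  by rewrite (bigD1 j)//= eqxx mul1r big1 ?addr0// => i /negbTE ->; rewrite mul0r.
split; first by rewrite addr0.
split=> // [|h s _ _|].
- rewrite (bigD1 j)//= eqxx cmod1 mul1r big1 ?addr0// => i /negbTE ->.
  by rewrite cmod0 mul0r.
- rewrite delta mxE (_ : _ - _ - _ = 0); last by ring.
  by rewrite cmod0 mulr0.
- by rewrite mul1r -[RHS](delta (fun i => z 0 i)); apply: eq_bigr => i _; rewrite mulrC.
Qed.

(** The product of two expansions has nine cross terms; grouped by order in s
    they are the terms of (A0 + A1 + A2) * (B0 + B1 + B2). *)
Lemma taylorM rho z f g n m (A B : R) :
  (exists D, taylor_at rho z f n A D) -> (exists D, taylor_at rho z g m B D) ->
  0 <= rho ->
  exists D, taylor_at rho z (fun z => f z * g z) (n + m) (A * B) D.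
Proof.
move=> [D [A0 [A1 [A2 [[A10 A20 AA] [fA0 DA1 rA eA]]]]]].
move=> [E [B0 [B1 [B2 [[B10 B20 BB] [gB0 EB1 rB eB]]]]]] rho0.
have A00 : 0 <= A0 by exact: le_trans (cmod_ge0 _) fA0.
have B00 : 0 <= B0 by exact: le_trans (cmod_ge0 _) gB0.
exists (fun j => D j * g z + f z * E j).
exists (A0 * B0), (A0 * B1 + A1 * B0), (A0 * B2 + A2 * B0 + A1 * B1 + A1 * B2 + A2 * B1 + A2 * B2).
have AB : (A0 + A1 + A2) * (B0 + B1 + B2) <= A * B by apply: ler_pM; rewrite ?addr_ge0.
split; first by split; [rewrite addr_ge0 ?mulr_ge0|rewrite !addr_ge0 ?mulr_ge0|lra].
split.
- by rewrite cmodM ler_pM ?cmod_ge0.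
- apply: (@le_trans _ _ (\sum_j (cmod (D j) * rho * cmod (g z) +
      cmod (f z) * (cmod (E j) * rho)))).
    apply: ler_sum => j _; apply: le_trans (ler_wpM2r rho0 (cmodD _ _)) _.
    by rewrite !cmodM; lra.
  rewrite big_split/= -big_distrl -big_distrr/= addrC.
  have s1 : 0 <= \sum_j cmod (D j) * rho.
    by apply: sumr_ge0 => j _; rewrite mulr_ge0 ?cmod_ge0.
  have s2 : 0 <= \sum_j cmod (E j) * rho.
    by apply: sumr_ge0 => j _; rewrite mulr_ge0 ?cmod_ge0.
  by rewrite lerD// ler_pM ?cmod_ge0.
- move=> h s s01 hs; have /andP[s0 s1] := s01.
  have lin (H : 'I_d -> C) (H1 : R) : \sum_j cmod (H j) * rho <= H1 ->
      cmod (\sum_j H j * h 0 j) <= s * H1.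
    move=> HH; apply: le_trans (cmod_sum _ _ _) _.
    apply: (@le_trans _ _ (\sum_j s * (cmod (H j) * rho))).
      apply: ler_sum => j _; rewrite cmodM [leRHS]mulrCA.
      by rewrite ler_wpM2l ?cmod_ge0.
    by rewrite -big_distrr/= ler_wpM2l.
  have lD := lin _ _ DA1; have lE := lin _ _ EB1.
  have {rA} := rA _ _ s01 hs; have {rB} := rB _ _ s01 hs.
  have -> : \sum_j (D j * g z + f z * E j) * h 0 j =
      (\sum_j D j * h 0 j) * g z + f z * (\sum_j E j * h 0 j).
    rewrite big_distrl big_distrr -big_split/=; apply: eq_bigr => j _.
    by rewrite mulrDl -!mulrA [h 0 j * _]mulrC.
  move: lD lE; set lf := \sum_j D j * _; set lg := \sum_j E j * _ => lD lE.
  set rf := f (z + h) - _ - _; set rg := g (z + h) - _ - _ => hrg hrf.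
  (* Orders one and zero cancel; every remaining term has order at least s^2. *)
  have -> : f (z + h) * g (z + h) - f z * g z - (lf * g z + f z * lg) =
      f z * rg + rf * g z + lf * lg + lf * rg + rf * lg + rf * rg.
    by rewrite /rf /rg; ring.
  have s20 : 0 <= s ^+ 2 by rewrite exprn_ge0.
  have s2s : s ^+ 2 <= s by rewrite expr2 ler_piMl.
  have s3s2 : s ^+ 2 * s <= s ^+ 2 by rewrite ler_piMr.
  have s4s2 : s ^+ 2 * s ^+ 2 <= s ^+ 2.
    by rewrite ler_piMr// (le_trans s2s).
  have tri x y (a b : R) : cmod x <= a -> cmod y <= b -> cmod (x + y) <= a + b.
    by move=> hx hy; apply: le_trans (cmodD _ _) (lerD hx hy).
  have bil x y (a b c : R) : cmod x <= a -> cmod y <= b -> a * b <= c ->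
      cmod (x * y) <= c.
    by move=> hx hy; apply: le_trans; rewrite cmodM ler_pM ?cmod_ge0.
  have -> : s ^+ 2 * (A0 * B2 + A2 * B0 + A1 * B1 + A1 * B2 + A2 * B1 + A2 * B2) =
      s ^+ 2 * (A0 * B2) + s ^+ 2 * (A2 * B0) + s ^+ 2 * (A1 * B1) +
      s ^+ 2 * (A1 * B2) + s ^+ 2 * (A2 * B1) + s ^+ 2 * (A2 * B2) by ring.
  do 5?[apply: (tri _ _ _ _)].
  + by apply: (bil _ _ _ _ _ fA0 hrg); rewrite mulrCA.
  + by apply: (bil _ _ _ _ _ hrf gB0); rewrite mulrA.
  + by apply: (bil _ _ _ _ _ lD lE); rewrite mulrACA -expr2.
  + apply: (bil _ _ _ _ _ lD hrg); rewrite mulrACA ler_wpM2r ?mulr_ge0//.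
    by rewrite mulrC.
  + by apply: (bil _ _ _ _ _ hrf lE); rewrite mulrACA ler_wpM2r ?mulr_ge0.
  + by apply: (bil _ _ _ _ _ hrf hrg); rewrite mulrACA ler_wpM2r ?mulr_ge0.
- under eq_bigr do rewrite mulrDr mulrA [_ * (f z * _)]mulrCA.
  by rewrite big_split/= -big_distrl -big_distrr/= eA eB natrD; ring.
Qed.

Definition monomial (alpha : 'I_d -> nat) z : C := \prod_j z 0 j ^+ alpha j.

Lemma taylor_monomial rho z alpha (c : C) : 0 <= rho ->
  exists D, taylor_at rho z (fun z => c * monomial alpha z) (\sum_j alpha j)
    (cmod c * \prod_j (cmod (z 0 j) + rho) ^+ alpha j) D.
Proof.
move=> rho0; rewrite -[(\sum_j alpha j)%N]add0n.
apply: taylorM => //; first exact: taylor_cst.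
have expo j n : exists D, taylor_at rho z (fun z => z 0 j ^+ n) n
    ((cmod (z 0 j) + rho) ^+ n) D.
  elim: n => [|n IH]; first by have := taylor_cst rho z 1; rewrite cmod1.
  rewrite (_ : (fun w : 'rV[C]_d => w 0 j ^+ n.+1) = (fun w => w 0 j * w 0 j ^+ n)).
    by rewrite exprS; exact: taylorM (taylor_coord z j rho0) IH rho0.
  by apply/funext => w; rewrite exprS.
rewrite /monomial; elim: (index_enum _) => [|j s IH].
  rewrite !big_nil (_ : (fun w : 'rV[C]_d => \prod_(j <- [::]) _) = (fun=> 1)).
    by have := taylor_cst rho z 1; rewrite cmod1.
  by apply/funext => w; rewrite big_nil.
rewrite !big_cons (_ : (fun w : 'rV[C]_d => \prod_(i <- j :: s) _) =
    (fun w => w 0 j ^+ alpha j * \prod_(i <- s) w 0 i ^+ alpha i)).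
  exact: taylorM (expo j (alpha j)) IH rho0.
by apply/funext => w; rewrite big_cons.
Qed.

(** Quadratic remainders over one common polydisc add up when their majorants
    are summable, and Euler's identity then evaluates the radial derivative
    term by term. *)
Lemma csum_differentiable (v : nat -> 'rV[C]_d -> C) z (n : nat -> nat)
    (rho : R) (M : nat -> R) (B B' : R) : 0 < rho ->
  (forall a, exists D, taylor_at rho z (v a) (n a) (M a) D) ->
  (forall N, \sum_(0 <= a < N) M a <= B) ->
  abs_bounded (fun a => (n a)%:R * v a z) B' ->
  differentiable (fun w => csum (fun a => v a w)) z /\
  radial_derivative (fun w => csum (fun a => v a w)) z =
    csum (fun a => (n a)%:R * v a z).
Proof.
move=> rho0 /choice[D hD] hM hB'.
have Mb (u : nat -> C) : (forall a, cmod (u a) <= M a) -> abs_bounded u B.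
  by move=> h N; apply: le_trans (hM N); apply: ler_sum.
have bv : abs_bounded (fun a => v a z) B.
  apply: Mb => a; have [M0 [M1 [M2 [[? ? ?] [h0 _ _ _]]]]] := hD a; lra.
have bD j : abs_bounded (fun a => D a j) (rho^-1 * B).
  move=> N; rewrite ler_pdivlMl// big_distrr/= -[leLHS]/(\sum_(0 <= a < N) _).
  apply: le_trans (hM N); apply: ler_sum => a _.
  have [M0 [M1 [M2 [[? ? ?] [h0 h1 _ _]]]]] := hD a.
  have := cmod_ge0 (v a z).
  rewrite (bigD1 j)//= in h1.
  have : 0 <= \sum_(i < d | i != j) cmod (D a i) * rho.
    by apply: sumr_ge0 => i _; rewrite mulr_ge0 ?cmod_ge0// ltW.
  lra.
have bDh (h : 'rV[C]_d) j : abs_bounded (fun a => h 0 j * D a j) (cmod (h 0 j) * (rho^-1 * B)).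
  exact: abs_boundedZ.
have rem h s a : 0 <= s <= 1 -> (forall j, cmod (h 0 j) <= s * rho) ->
    cmod (v a (z + h) - v a z - \sum_j D a j * h 0 j) <= s ^+ 2 * M a.
  move=> s01 hs; have [M0 [M1 [M2 [[? ? ?] [h0 h1 h2 _]]]]] := hD a.
  apply: le_trans (h2 _ _ s01 hs) _; rewrite ler_wpM2l ?sqr_ge0//.
  by have := cmod_ge0 (v a z); lra.
have [|df dD] := @differentiable_quadratic R d (fun w => csum (fun a => v a w)) z
  (fun j => csum (fun a => D a j)) rho (2 * B) rho0.
  move=> h s s01 hs; have /andP[s0 s1] := s01.
  have bvh : abs_bounded (fun a => v a (z + h)) B.
    apply: Mb => a; have [M0 [M1 [M2 [[? ? ?] [h0 h1 h2 _]]]]] := hD a.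
    have hl : cmod (\sum_j D a j * h 0 j) <= M1.
      apply: le_trans (cmod_sum _ _ _) _; apply: le_trans h1; apply: ler_sum => j _.
      rewrite cmodM ler_wpM2l ?cmod_ge0//; apply: le_trans (hs j) _.
      by rewrite ler_piMl ?(ltW rho0).
    have s21 : s ^+ 2 * M2 <= M2 by rewrite ler_piMl// exprn_ile1.
    have := le_trans (h2 _ _ s01 hs) s21; set r := _ - _ - _ => hr.
    have -> : v a (z + h) = r + v a z + \sum_j D a j * h 0 j by rewrite /r; ring.
    have := cmodD (r + v a z) (\sum_j D a j * h 0 j); have := cmodD r (v a z); lra.
  have -> : csum (fun a => v a (z + h)) - csum (fun a => v a z) -
      \sum_j csum (fun a => D a j) * h 0 j =
      csum (fun a => v a (z + h) - v a z - \sum_j D a j * h 0 j).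
    have E1 : \sum_j csum (fun a => D a j) * h 0 j =
        csum (fun a => \sum_j h 0 j * D a j).
      rewrite (csum_sum _ (bDh h)); apply: eq_bigr => j _.
      by rewrite (csumZ _ (bD j)) mulrC.
    have bE := abs_bounded_sum (index_enum 'I_d) (bDh h).
    rewrite E1 -(mulN1r (csum (fun a => v a z))) -(csumZ (-1) bv).
    rewrite -(mulN1r (csum (fun a => \sum_j _))) -(csumZ (-1) bE).
    rewrite -(csumD bvh (abs_boundedZ (-1) bv)).
    rewrite -(csumD (abs_boundedD bvh (abs_boundedZ (-1) bv)) (abs_boundedZ (-1) bE)).
    congr csum; apply/funext => a; rewrite !mulN1r; congr (_ - _).
    by apply: eq_bigr => j _; rewrite mulrC.
  rewrite [leRHS]mulrCA; apply: cmod_csum_le => N.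
  apply: (@le_trans _ _ (\sum_(0 <= a < N) s ^+ 2 * M a)).
    by apply: ler_sum => a _; exact: rem.
  by rewrite -big_distrr/= ler_wpM2l ?sqr_ge0.
split=> //; rewrite /radial_derivative.
have -> : (fun a => (n a)%:R * v a z) = fun a => \sum_j z 0 j * D a j.
  by apply/funext => a; have [? [? [? [_ [_ _ _ ->]]]]] := hD a.
rewrite (csum_sum _ (bDh z)); apply: eq_bigr => j _.
rewrite dD (csumZ _ (bD j)) (bigD1 j)//= mxE !eqxx mulr1 big1 ?addr0// => i ij.
by rewrite mxE (negbTE ij) andbF mulr0.
Qed.

End taylor.

(** * Gaussian sums over the integers *)

Section gaussian_sum.
Variable R : realType.

Lemma geometric_half_le (N : nat) : \sum_(0 <= k < N) (2^-1 : R) ^+ k <= 2.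
Proof.
suff -> : \sum_(0 <= k < N) (2^-1 : R) ^+ k = 2 - 2 * 2^-1 ^+ N.
  by rewrite lerBlDr lerDl mulr_ge0 ?exprn_ge0.
elim: N => [|N IH]; first by rewrite big_geq// expr0; lra.
by rewrite big_nat_recr//= IH exprS; lra.
Qed.

Definition gauss_bound : R := 4 * expR (3 / 2).

Lemma gauss_bound_ge1 : 1 <= gauss_bound.
Proof.
have : 1 <= expR (3 / 2) :> R by rewrite -[leLHS]expR0 ler_expR; lra.
by rewrite /gauss_bound; lra.
Qed.

Lemma gauss_le_geometric (t : R) (k : nat) : k%:R <= `|t| + 1 ->
  expR (- (t ^+ 2 / 2)) <= expR (3 / 2) * 2^-1 ^+ k.
Proof.
move=> kt; have e2 : (2 : R) <= expR 1 by have := @expR_ge1Dx R 1; lra.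
apply: (@le_trans _ _ (expR (3 / 2) * expR (- k%:R))).
  rewrite -expRD ler_expR -(real_normK (num_real t)).
  by have := sqr_ge0 (`|t| - 1); lra.
rewrite ler_wpM2l ?expR_ge0// expRN exprVn lef_pV2 ?posrE ?exprn_gt0 ?expR_gt0//.
by rewrite -[k%:R]mulr1 expRM_natl lerXn2r ?nnegrE ?expR_ge0.
Qed.

(** The bound must not depend on the centre w: at most two integers lie at
    each rounded distance from w, and the Gaussian decays at least
    geometrically. *)
Lemma gauss_sum_le (w : R) (M : nat) : 0 <= w ->
  \sum_(0 <= m < M) expR (- ((w - m%:R) ^+ 2 / 2)) <= gauss_bound.
Proof.
move=> w0; have /andP[p1 p2] := truncn_itv w0; set p := Num.truncn w in p1 p2.
rewrite -natr1 in p2.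
apply: (@le_trans _ _ (\sum_(0 <= m < M + p.+1) expR (- ((w - m%:R) ^+ 2 / 2)))).
  rewrite [leRHS](big_cat_nat (n := M))//= ?leq_addr//.
  by rewrite lerDl; apply: sumr_ge0 => m _; exact: expR_ge0.
rewrite [leLHS](big_cat_nat (n := p.+1))//= ?leq_addl//.
have -> : gauss_bound = expR (3 / 2) * 2 + expR (3 / 2) * 2.
  by rewrite /gauss_bound; ring.
apply: lerD.
  rewrite big_nat_rev/= add0n.
  apply: le_trans (ler_wpM2l (expR_ge0 _) (geometric_half_le p.+1)).
  rewrite big_distrr/=; apply: ler_sum_nat => k /andP[_ kp].
  apply: gauss_le_geometric; rewrite subSS natrB//.
  by have := ler_norm (w - (p%:R - k%:R)); lra.
rewrite -{1}[p.+1]add0n big_addn addnK.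
apply: le_trans (ler_wpM2l (expR_ge0 _) (geometric_half_le M)).
rewrite big_distrr/=; apply: ler_sum_nat => k _.
apply: gauss_le_geometric; rewrite natrD -natr1 distrC.
by have := ler_norm (k%:R + (p%:R + 1) - w); lra.
Qed.

End gaussian_sum.

(** * Monomials that peak at a prescribed point of the sphere *)

Section peaked_monomials.
Variables (R : realType) (d : nat).
Implicit Types (n : nat) (i j : 'I_d) (m : 'I_d -> nat) (x : 'I_d -> R).

(** All exponents but the i-th are perfect squares, and the i-th completes the
    degree to n.  Squares are the right spacing because a peaked monomial is
    a Gaussian in the square roots of its exponents. *)
Definition expo n i m j : nat :=
  if j == i then (n - \sum_(l | l != i) m l ^ 2)%N else (m j ^ 2)%N.

Definition admissible n i m := (m i == 0%N) && (\sum_(l | l != i) m l ^ 2 <= n)%N.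

Lemma sum_expo n i m : admissible n i m -> (\sum_j expo n i m j)%N = n.
Proof.
move=> /andP[_ mn]; rewrite (bigD1 i)//= {1}/expo eqxx.
rewrite (eq_bigr (fun j => m j ^ 2)%N) ?subnK// => j /negbTE ji.
by rewrite /expo ji.
Qed.

(** By weighted arithmetic and geometric means, |z^alpha| has maximum
    prod_j (alpha_j / n)^(alpha_j / 2) on the unit sphere when alpha has
    degree n; this is the inverse of that maximum, with factor 1 wherever
    alpha_j = 0. *)
Definition peak n (alpha : 'I_d -> nat) : R :=
  \prod_j Num.sqrt (n%:R / (alpha j)%:R) ^+ alpha j.

Lemma peak_ge0 n alpha : 0 <= peak n alpha.
Proof. by apply: prodr_ge0 => j _; rewrite exprn_ge0. Qed.

(** The inequality t <= exp (t - 1) at t = w / sqrt a, raised to the power a. *)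
Lemma power_le_expR (w : R) (a : nat) : 0 <= w ->
  (w / Num.sqrt a%:R) ^+ a <= expR (w * Num.sqrt a%:R - a%:R).
Proof.
move=> w0; case: a => [|a]; first by rewrite expr0 sqrtr0 mulr0 subr0 expR0.
set s := Num.sqrt _; have s0 : 0 < s by rewrite sqrtr_gt0.
have sE : s ^+ 2 = a.+1%:R by rewrite sqr_sqrtr.
have -> : w * s - a.+1%:R = a.+1%:R * (w / s - 1).
  by rewrite -sE; field; rewrite gt_eqF.
rewrite expRM_natl lerXn2r ?nnegrE ?expR_ge0 ?divr_ge0 ?(ltW s0)//.
by have := @expR_ge1Dx R (w / s - 1); lra.
Qed.

Lemma sqrt_div_scale n (a : nat) (r t : R) : 0 < r ->
  Num.sqrt (n%:R / a%:R) * t = r * (Num.sqrt n%:R * t / r / Num.sqrt a%:R).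
Proof.
move=> r0; rewrite sqrtrM// sqrtrV//.
have -> : r * (Num.sqrt n%:R * t / r / Num.sqrt a%:R) =
  (r / r) * (Num.sqrt n%:R * t / Num.sqrt a%:R) by ring.
by rewrite divff ?gt_eqF//; ring.
Qed.

Lemma peaked_monomialE n alpha x :
  peak n alpha * \prod_j x j ^+ alpha j =
  \prod_j (Num.sqrt (n%:R / (alpha j)%:R) * x j) ^+ alpha j.
Proof. by rewrite -big_split/=; apply: eq_bigr => j _; rewrite exprMn. Qed.

(** With w_j = sqrt n x_j / r, the exponents w_j sqrt alpha_j - alpha_j left by
    the previous bound complete to -(w_j - sqrt alpha_j)^2 / 2, because both
    the alpha_j and the w_j^2 sum up to at most n. *)
Lemma peaked_monomial_le n i m x (r : R) : admissible n i m -> 0 < r ->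
  (forall j, 0 <= x j) -> \sum_j x j ^+ 2 <= r ^+ 2 ->
  peak n (expo n i m) * \prod_j x j ^+ expo n i m j <=
  r ^+ n * \prod_(j | j != i) expR (- ((Num.sqrt n%:R * x j / r - (m j)%:R) ^+ 2 / 2)).
Proof.
move=> adm r0 x0 xr; set alpha := expo n i m.
have sa : (\sum_j alpha j)%N = n by exact: sum_expo.
pose w j := Num.sqrt n%:R * x j / r.
have w0 j : 0 <= w j by rewrite divr_ge0 ?mulr_ge0 ?(ltW r0).
have sw : \sum_j w j ^+ 2 <= n%:R.
  have -> : \sum_j w j ^+ 2 = n%:R / r ^+ 2 * \sum_j x j ^+ 2.
    rewrite big_distrr/=; apply: eq_bigr => j _.
    by rewrite /w expr_div_n exprMn sqr_sqrtr// mulrAC.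
  by rewrite mulrAC ler_pdivrMr ?exprn_gt0// ler_wpM2l.
rewrite peaked_monomialE.
under eq_bigr do rewrite (sqrt_div_scale _ _ _ r0) exprMn.
rewrite big_split/= prodrXr sa ler_wpM2l ?exprn_ge0 ?(ltW r0)//.
apply: (@le_trans _ _ (\prod_j expR (w j * Num.sqrt (alpha j)%:R - (alpha j)%:R))).
  apply: ler_prod => j _; apply/andP; split; last exact: power_le_expR (w0 j).
  by apply: exprn_ge0; apply: divr_ge0 => //; exact: w0.
rewrite -expR_sum -expR_sum ler_expR.
have -> : \sum_(j | j != i) - ((Num.sqrt n%:R * x j / r - (m j)%:R) ^+ 2 / 2) =
    \sum_(j | j != i) - ((w j - Num.sqrt (alpha j)%:R) ^+ 2 / 2).
  apply: eq_bigr => j /negbTE ji; rewrite /alpha /expo ji natrX sqrtr_sqr.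
  by rewrite ger0_norm.
apply: (@le_trans _ _ (\sum_j - ((w j - Num.sqrt (alpha j)%:R) ^+ 2 / 2))); last first.
  rewrite [leLHS](bigD1 i)//= gerDr oppr_le0 divr_ge0 ?sqr_ge0//.
have san : \sum_j (alpha j)%:R = n%:R :> R by rewrite -natr_sum sa.
rewrite -subr_ge0 -sumrB.
rewrite (eq_bigr (fun j => 2^-1 * (alpha j)%:R - 2^-1 * w j ^+ 2)) => [|j _].
  by rewrite sumrB -!big_distrr/= san; lra.
have := @sqr_sqrtr R (alpha j)%:R (ler0n _ _).
by set s := Num.sqrt _ => <-; field.
Qed.

(** The inequality exp (1 - 1 / t) <= t at t = y / a, raised to the power a,
    and written so that the first-order terms cancel upon summation. *)
Lemma power_ge_expR (y : R) (a : nat) : 0 <= y -> (y = 0 -> a = 0%N) ->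
  expR ((y - a%:R) - (y - a%:R) ^+ 2 / y) <= (y / a%:R) ^+ a.
Proof.
move=> y0 ya; have [->|a0] := eqVneq a 0%N.
  rewrite subr0 expr0; have [->|yn0] := eqVneq y 0.
    by rewrite expr0n/= mul0r subr0 expR0.
  by rewrite expr2 mulfK// subrr expR0.
have yn0 : y != 0 by apply: contraNneq a0 => /ya ->.
have yp : 0 < y by rewrite lt_def yn0.
have ap : 0 < a%:R :> R by rewrite ltr0n lt0n.
have -> : (y - a%:R) - (y - a%:R) ^+ 2 / y = a%:R * (1 - a%:R / y) by field.
rewrite expRM_natl lerXn2r ?nnegrE ?expR_ge0 ?divr_ge0 ?(ltW ap)//.
have := @expR_ge1Dx R (a%:R / y - 1); rewrite addrC subrK => h.
rewrite -[y / _]invrK invf_div -[1 - _]opprB expRN lef_pV2 ?posrE ?expR_gt0//.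
exact: divr_gt0.
Qed.

(** The relative loss caused by rounding the ideal exponents: 4 for each
    rounded coordinate and 4 d^3 for the coordinate that takes up the slack. *)
Definition peak_loss : R := expR (- (4 * d%:R + 4 * d%:R ^+ 3)).

(** The ideal exponents are y_j = n x_j^2 / r^2.  Rounding the square root of
    y_j down moves y_j by at most 2 sqrt y_j, which costs a bounded factor;
    the accumulated error of order sqrt n is put on the largest coordinate,
    where y_i >= n / d makes it harmless too. *)
Lemma peaked_monomial_ge n x (r : R) : (0 < d)%N -> 0 <= r ->
  (forall j, 0 <= x j) -> \sum_j x j ^+ 2 = r ^+ 2 ->
  exists i m, admissible n i m /\
    peak_loss * r ^+ n ^+ 2 <=
    (peak n (expo n i m) * \prod_j x j ^+ expo n i m j) ^+ 2.
Proof.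
move=> d0 r0 x0 xr; rewrite /peak_loss; set K := expR _.
have K1 : K <= 1.
  by rewrite -[leRHS]expR0 ler_expR oppr_le0 addr_ge0 ?mulr_ge0 ?exprn_ge0.
pose i0 := Ordinal d0.
pose i := [arg max_(j > i0) x j]%O.
have xi j : x j <= x i by rewrite /i; case: arg_maxP => // k _; apply.
have [n0|n0] := posnP n.
  exists i, (fun=> 0%N); rewrite n0; split=> //.
    by rewrite /admissible eqxx big1.
  rewrite expr0 expr1n mulr1 /peak !big1 ?mulr1 ?expr1n// => j _.
    by rewrite /expo sub0n if_same.
  by rewrite /expo sub0n if_same.
move: r0; rewrite le_eqVlt => /predU1P[r00|r0].
  exists i, (fun=> 0%N); split=> //; first by rewrite /admissible eqxx big1.
  by rewrite -r00 expr0n gtn_eqF// expr0n mulr0 sqr_ge0.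
have nR : 0 < n%:R :> R by rewrite ltr0n.
pose y j := n%:R * x j ^+ 2 / r ^+ 2.
have y0 j : 0 <= y j.
  by apply: divr_ge0; [apply: mulr_ge0; [exact: ler0n|exact: sqr_ge0]|exact: sqr_ge0].
have sy : \sum_j y j = n%:R.
  rewrite -big_distrl -big_distrr/= xr -mulrA divff ?mulr1// gt_eqF//.
  by rewrite exprn_gt0.
have yn j : y j <= n%:R.
  by rewrite -sy (bigD1 j)//= lerDl sumr_ge0.
pose w j := Num.sqrt (y j).
have w0 j : 0 <= w j by exact: sqrtr_ge0.
have wE j : w j ^+ 2 = y j by rewrite sqr_sqrtr.
pose m j := if j == i then 0%N else Num.truncn (w j).
pose alpha := expo n i m.
have mw j : j != i -> [/\ (m j)%:R <= w j & w j < (m j)%:R + 1].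
  move=> /negbTE ji; rewrite /m ji; have /andP[? ?] := truncn_itv (w0 j).
  by rewrite natr1.
have mY j : j != i -> (m j ^ 2)%:R <= y j.
  move=> ji; have [h _] := mw j ji.
  by rewrite natrX -wE ler_pXn2r ?nnegrE.
have adm : admissible n i m.
  rewrite /admissible {1}/m eqxx eqxx /= -(ler_nat R) natr_sum -sy.
  rewrite [leRHS](bigD1 i)//=; apply: le_trans (ler_wpDl (y0 i) (lexx _)).
  exact: ler_sum.
have sa : \sum_j (alpha j)%:R = n%:R :> R by rewrite -natr_sum (sum_expo adm).
have gap j : j != i -> 0 <= y j - (alpha j)%:R <= 2 * w j.
  move=> ji; have [h1 h2] := mw j ji; rewrite /alpha /expo (negbTE ji).
  rewrite subr_ge0 mY//= -wE natrX.
  have : 0 <= (m j)%:R :> R by [].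
  have := w0 j; nra.
have gap4 j : j != i -> (y j - (alpha j)%:R) ^+ 2 / y j <= 4.
  move=> ji; have /andP[h1 h2] := gap j ji.
  have [yj0|yj0] := eqVneq (y j) 0; first by rewrite yj0 invr0 mulr0.
  rewrite ler_pdivrMr; last by rewrite lt_def yj0 y0.
  rewrite -[in leRHS]wE (_ : 4 * w j ^+ 2 = (2 * w j) ^+ 2); last by ring.
  by rewrite ler_pXn2r ?nnegrE ?mulr_ge0.
have dR : 1 <= d%:R :> R by rewrite ler1n.
have yi : n%:R <= d%:R * y i.
  rewrite -sy mulr_natl -[X in _ *+ X]card_ord -sumr_const; apply: ler_sum => k _.
  rewrite /y ler_pM2r ?invr_gt0 ?exprn_gt0// ler_wpM2l//.
  by rewrite ler_pXn2r ?nnegrE.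
have gapi : (y i - (alpha i)%:R) ^+ 2 / y i <= 4 * d%:R ^+ 3.
  have yip : 0 < y i.
    by have := lt_le_trans nR yi; rewrite pmulr_rgt0// (lt_le_trans ltr01).
  have E : (alpha i)%:R - y i = \sum_(j | j != i) (y j - (alpha j)%:R).
    have := sa; rewrite (bigD1 i)//= => e1; have := sy; rewrite (bigD1 i)//= => e2.
    by rewrite sumrB; lra.
  have E0 : 0 <= (alpha i)%:R - y i.
    by rewrite E sumr_ge0// => j ji; case/andP: (gap j ji).
  have E1 : (alpha i)%:R - y i <= 2 * d%:R * Num.sqrt n%:R.
    rewrite E; apply: (@le_trans _ _ (\sum_(j : 'I_d) 2 * Num.sqrt n%:R)).
      rewrite [leRHS](bigD1 i)//=.
      apply: le_trans (ler_wpDl (_ : 0 <= 2 * Num.sqrt n%:R) (lexx _)).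
        apply: ler_sum => j ji; have /andP[_ h] := gap j ji; apply: le_trans h _.
        by rewrite ler_wpM2l// ler_wsqrtr.
      by rewrite mulr_ge0.
    by rewrite sumr_const card_ord -[_ *+ d]mulr_natl mulrA [d%:R * 2]mulrC.
  rewrite ler_pdivrMr// -[X in X ^+ 2]opprB sqrrN.
  apply: (@le_trans _ _ ((2 * d%:R * Num.sqrt n%:R) ^+ 2)).
    by rewrite ler_pXn2r ?nnegrE ?mulr_ge0.
  rewrite exprMn sqr_sqrtr//.
  have : (2 * d%:R) ^+ 2 * n%:R <= (2 * d%:R) ^+ 2 * (d%:R * y i) by rewrite ler_wpM2l ?sqr_ge0.
  lra.
exists i, m; split=> //.
rewrite peaked_monomialE -prodrXl.
have factor j : ((Num.sqrt (n%:R / (alpha j)%:R) * x j) ^+ alpha j) ^+ 2 =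
    (r ^+ 2) ^+ alpha j * (y j / (alpha j)%:R) ^+ alpha j.
  rewrite -[RHS]exprMn exprAC; congr (_ ^+ _).
  rewrite exprMn sqr_sqrtr ?divr_ge0// /y.
  have -> : r ^+ 2 * (n%:R * x j ^+ 2 / r ^+ 2 / (alpha j)%:R) =
    (r ^+ 2 / r ^+ 2) * (n%:R / (alpha j)%:R * x j ^+ 2) by ring.
  by rewrite divff ?mul1r// gt_eqF// exprn_gt0.
under eq_bigr do rewrite factor.
rewrite big_split/= prodrXr (sum_expo adm) [in leRHS]exprAC [leLHS]mulrC.
rewrite ler_wpM2l ?sqr_ge0//.
apply: (@le_trans _ _ (\prod_j expR ((y j - (alpha j)%:R) - (y j - (alpha j)%:R) ^+ 2 / y j))).
  rewrite -expR_sum /K ler_expR sumrB sumrB sy sa subrr sub0r lerN2.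
  rewrite (bigD1 i)//= addrC lerD//.
  apply: (@le_trans _ _ (\sum_(j : 'I_d) 4)).
    rewrite [leRHS](bigD1 i)//=; apply: le_trans (ler_wpDl (_ : 0 <= 4) (lexx _)) => //.
    exact: ler_sum.
  by rewrite sumr_const card_ord mulr_natr.
apply: ler_prod => j _; rewrite expR_ge0/=; apply: power_ge_expR => // yj0.
have [ji|ji] := eqVneq j i.
  have := yi; rewrite -ji yj0 mulr0 leNgt nR.
  by [].
have := mY j ji; rewrite yj0 lern0 /alpha /expo (negbTE ji).
by move/eqP.
Qed.

End peaked_monomials.

(** * Summing the peaked monomials over all levels *)

Section flattening.
Variables (R : realType) (d : nat).
Local Notation index := (nat * 'I_d * {ffun 'I_d -> nat})%type.
Implicit Types (F : index -> R) (x : 'I_d -> R).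

Lemma ler_sum_subset (T : eqType) (s t : seq T) (F : T -> R) :
  (forall a, 0 <= F a) -> uniq s -> {subset s <= t} ->
  \sum_(a <- s) F a <= \sum_(a <- t) F a.
Proof.
move=> F0; elim: s t => [|a s IH] t /=; first by rewrite big_nil sumr_ge0.
move=> /andP[as_ us] st; have at_ : a \in t by apply: st; rewrite mem_head.
rewrite [leRHS](perm_big _ (perm_to_rem at_)) !big_cons lerD2l; apply: IH => // b bs.
have : b \in t by apply: st; rewrite inE bs orbT.
rewrite (perm_mem (perm_to_rem at_)) inE => /orP[/eqP ba|//].
by rewrite -ba bs in as_.
Qed.

(** Doubly indexed families are laid out along the natural numbers, because
    each member needs its own Rademacher sign. *)
Definition flat F (a : nat) : R := oapp F 0 (pickle_inv a).

Lemma flat_ge0 F a : (forall t, 0 <= F t) -> 0 <= flat F a.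
Proof. by rewrite /flat => F0; case: pickle_inv => /=. Qed.

Lemma flat_pickle F t : flat F (pickle t) = F t.
Proof. by rewrite /flat pickleK_inv. Qed.

Lemma flat_sum_le F N : (forall t, 0 <= F t) -> exists K M,
  \sum_(0 <= a < N) flat F a <=
  \sum_(k < K) \sum_i \sum_(m : {ffun 'I_d -> 'I_M}) F (k : nat, i, [ffun j => m j : nat]).
Proof.
move=> F0; pose L : seq index := pmap pickle_inv (index_iota 0 N).
have -> : \sum_(0 <= a < N) flat F a = \sum_(t <- L) F t.
  rewrite /L; elim: (index_iota 0 N) => [|a s IH]; first by rewrite !big_nil.
  rewrite big_cons IH /= /flat; case: pickle_inv => [t|] /=; last by rewrite add0r.
  by rewrite big_cons.
have uL : uniq L by apply: (pmap_uniq (@pickle_invK _)); exact: iota_uniq.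
have [K [M hKM]] : exists K M, forall t, t \in L ->
    (t.1.1 < K)%N /\ forall j, (t.2 j < M)%N.
  elim: {uL} L => [|t L [K [M h]]]; first by exists 0%N, 0%N.
  exists (maxn K t.1.1.+1), (maxn M (\max_j t.2 j).+1) => u; rewrite inE.
  case/orP => [/eqP ->|/h[h1 h2]]; split=> [|j].
  - by rewrite leq_max ltnSn orbT.
  - by rewrite leq_max orbC ltnS leq_bigmax.
  - by rewrite leq_max h1.
  - by rewrite leq_max h2.
exists K, M; pose phi (u : 'I_K * 'I_d * {ffun 'I_d -> 'I_M}) : index :=
  (u.1.1 : nat, u.1.2, [ffun j => u.2 j : nat]).
rewrite pair_big pair_big /= -(big_map phi xpredT F).
apply: ler_sum_subset => // -[[k i] m] /hKM /= [kK mM].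
have -> : (k, i, m) = phi (Ordinal kK, i, [ffun j => Ordinal (mM j)]).
  by congr (_, _, _); apply/ffunP => j; rewrite !ffunE.
by rewrite map_f// mem_index_enum.
Qed.

Lemma flat_sum_ge F (t : nat -> index) K : (forall u, 0 <= F u) -> injective t ->
  exists N, \sum_(0 <= k < K) F (t k) <= \sum_(0 <= a < N) flat F a.
Proof.
move=> F0 tinj; exists (\max_(k < K) pickle (t k)).+1.
under eq_bigr do rewrite -flat_pickle.
rewrite -(big_map (fun k => pickle (t k)) xpredT (flat F)).
apply: ler_sum_subset => [a||a /mapP[k]]; first exact: flat_ge0.
  by rewrite map_inj_uniq ?iota_uniq// => k l /(pcan_inj pickleK) /tinj.
rewrite mem_index_iota /= => kK ->; rewrite mem_index_iota /= ltnS.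
exact: (@leq_bigmax _ (fun k : 'I_K => pickle (t k)) (Ordinal kK)).
Qed.

(** Degree 2^k - 1 instead of 2^k makes level 0 the constants, so that the
    lower bound also holds at the origin. *)
Definition deg (k : nat) : nat := (2 ^ k).-1.

Definition term (W : nat -> R) x (t : index) : R :=
  let: (k, i, m) := t in
  if admissible (deg k) i m then
    W k * (peak R (deg k) (expo (deg k) i m) * \prod_j x j ^+ expo (deg k) i m j)
  else 0.

Lemma term_ge0 W x t : (forall k, 0 <= W k) -> (forall j, 0 <= x j) ->
  0 <= term W x t.
Proof.
case: t => [[k i] m] W0 x0 /=; case: ifP => // _.
by rewrite !mulr_ge0 ?peak_ge0// prodr_ge0// => j _; rewrite exprn_ge0.
Qed.

Definition family_bound : R := d%:R * gauss_bound R ^+ d.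

(** The Gaussian bound is a product over the coordinates, hence the sum over
    all admissible exponents of one level is at most a product of
    one-dimensional Gaussian sums. *)
Lemma level_sum_le n M x (r : R) : 0 < r -> (forall j, 0 <= x j) ->
  \sum_j x j ^+ 2 <= r ^+ 2 ->
  \sum_i \sum_(m : {ffun 'I_d -> 'I_M} | admissible n i (fun j => m j))
     peak R n (expo n i (fun j => m j)) * \prod_j x j ^+ expo n i (fun j => m j) j
  <= family_bound * r ^+ n.
Proof.
move=> r0 x0 xr; rewrite /family_bound -mulrA.
have -> : d%:R * (gauss_bound R ^+ d * r ^+ n) = \sum_(i < d) gauss_bound R ^+ d * r ^+ n.
  by rewrite sumr_const card_ord mulr_natl.
apply: ler_sum => i _.
pose w j := Num.sqrt n%:R * x j / r.
(* The slot i carries no free exponent: admissibility forces it to be 0 there. *)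
pose b j (m : nat) : R := if j == i then (m == 0%N)%:R
  else expR (- ((w j - m%:R) ^+ 2 / 2)).
have b0 j m : 0 <= b j m by rewrite /b; case: ifP => _; rewrite ?expR_ge0.
apply: (@le_trans _ _ (\sum_(m : {ffun 'I_d -> 'I_M}) r ^+ n * \prod_j b j (m j))).
  rewrite big_mkcond/=; apply: ler_sum => m _; case: ifP => [adm|_]; last first.
    by rewrite mulr_ge0 ?exprn_ge0 ?(ltW r0)// prodr_ge0.
  apply: le_trans (peaked_monomial_le adm r0 x0 xr) _.
  rewrite ler_wpM2l ?exprn_ge0 ?(ltW r0)// [leRHS](bigD1 i)//= {1}/b eqxx.
  case/andP: adm => -> _; rewrite mul1r.
  rewrite [leRHS](eq_bigr (fun j => expR (- ((w j - (m j)%:R) ^+ 2 / 2))))//.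
  by move=> j /negbTE ji; rewrite /b ji.
rewrite -big_distrr/= mulrC ler_wpM2r ?exprn_ge0 ?(ltW r0)//.
rewrite -(bigA_distr_bigA (fun j (m : 'I_M) => b j m))/=.
rewrite -[d in X in _ <= X]card_ord -prodr_const; apply: ler_prod => j _.
rewrite sumr_ge0//=; have [ji|ji] := eqVneq j i.
  apply: le_trans (@gauss_bound_ge1 R).
  rewrite (eq_bigr (fun m : 'I_M => ((m : nat) == 0%N)%:R)) => [|m _]; last first.
    by rewrite /b ji eqxx.
  case: (M) => [|M']; first by rewrite big_ord0.
  by rewrite big_ord_recl/= big1 ?addr0.
rewrite (eq_bigr (fun m : 'I_M => expR (- ((w j - m%:R) ^+ 2 / 2)))) => [|m _]; last first.
  by rewrite /b (negbTE ji).
rewrite -(big_mkord xpredT (fun m => expR (- ((w j - m%:R) ^+ 2 / 2)))).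
by apply: gauss_sum_le; rewrite divr_ge0 ?mulr_ge0 ?(ltW r0).
Qed.

Lemma flat_term_le W x (r B : R) N : (forall k, 0 <= W k) -> 0 < r ->
  (forall j, 0 <= x j) -> \sum_j x j ^+ 2 <= r ^+ 2 ->
  (forall K, \sum_(0 <= k < K) W k * r ^+ deg k <= B) ->
  \sum_(0 <= a < N) flat (term W x) a <= family_bound * B.
Proof.
move=> W0 r0 x0 xr hB.
have [K [M h]] := flat_sum_le N (fun t => term_ge0 t W0 x0).
apply: le_trans h _; have fb0 : 0 <= family_bound.
  by rewrite mulr_ge0 ?exprn_ge0// (le_trans ler01 (@gauss_bound_ge1 R)).
apply: le_trans (ler_wpM2l fb0 (hB K)).
rewrite big_mkord big_distrr/=; apply: ler_sum => k _.
rewrite mulrCA; apply: le_trans (ler_wpM2l (W0 k) (level_sum_le (deg k) M r0 x0 xr)).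
rewrite big_distrr/=; apply: ler_sum => i _.
rewrite big_distrr/= [leRHS]big_mkcond/=; apply: ler_sum => m _ /=.
have -> : [ffun j => (m j : nat)] = (fun j => m j : nat) :> ('I_d -> nat).
  by apply/funext => j; rewrite ffunE.
by [].
Qed.

(** It suffices to keep one monomial per level, the one that peaks near the
    given point. *)
Lemma flat_term_ge W x (r : R) K : (0 < d)%N -> (forall k, 0 <= W k) -> 0 <= r ->
  (forall j, 0 <= x j) -> \sum_j x j ^+ 2 = r ^+ 2 ->
  exists N, peak_loss R d * \sum_(0 <= k < K) (W k * r ^+ deg k) ^+ 2 <=
    \sum_(0 <= a < N) flat (term W x) a ^+ 2.
Proof.
move=> d0 W0 r0 x0 xr.
have best k : exists t : index, t.1.1 = k /\
    peak_loss R d * (W k * r ^+ deg k) ^+ 2 <= term W x t ^+ 2.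
  have [i [m [adm h]]] := peaked_monomial_ge (deg k) d0 r0 x0 xr.
  exists (k, i, [ffun j => m j]); split=> //=.
  have -> : [ffun j => m j] = m :> ('I_d -> nat) by apply/funext => j; rewrite ffunE.
  by rewrite adm [in leLHS]exprMn mulrCA [leRHS]exprMn ler_wpM2l ?sqr_ge0.
have [t ht] := choice best.
have tinj : injective t.
  by move=> k l tkl; have [<- _] := ht k; have [<- _] := ht l; rewrite tkl.
have [N hN] := flat_sum_ge K (fun u => sqr_ge0 (term W x u)) tinj.
exists N; rewrite big_distrr/=.
apply: (@le_trans _ _ (\sum_(0 <= k < K) term W x (t k) ^+ 2)).
  by apply: ler_sum => k _; have [_] := ht k.
apply: le_trans hN _; apply: ler_sum => a _.
by rewrite /flat; case: pickle_inv => [u|] //=; rewrite expr0n.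
Qed.

End flattening.

(** * Dyadic sums of the weight *)

Section dyadic_sums.
Variables (R : realType) (omega : R -> R).
Hypothesis omega_gt0 : forall t : R, 0 < t <= 1 -> 0 < omega t.
Hypothesis omega_incr : forall s t : R, 0 < s -> s <= t -> t <= 1 ->
  omega s <= omega t.
Local Notation mu := (@lebesgue_measure R).

Definition weight (k : nat) : R := omega (2^-1 ^+ k).

Lemma dyadic_itv (k : nat) : 0 < (2^-1 : R) ^+ k <= 1.
Proof.
have h : 0 <= (2^-1 : R) <= 1 by lra.
by case/andP: h => h1 h2; rewrite exprn_gt0//= ?exprn_ile1//; lra.
Qed.

Lemma weight_gt0 k : 0 < weight k.
Proof. exact/omega_gt0/dyadic_itv. Qed.

Lemma weight_le0 k : weight k <= weight 0.
Proof.
have /andP[h1 h2] := dyadic_itv k.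
by apply: omega_incr => //; rewrite expr0.
Qed.

Lemma deg_natr k : (deg k)%:R = 2 ^+ k - 1 :> R.
Proof. by rewrite /deg -subn1 natrB ?natrX// expn_gt0. Qed.

Lemma leq_deg k : (k <= deg k)%N.
Proof. by rewrite /deg -ltnS prednK ?expn_gt0// ltn_expl. Qed.

Lemma level_series_bounded (r : R) K : 0 <= r < 1 ->
  \sum_(0 <= k < K) weight k * r ^+ deg k <= weight 0 / (1 - r).
Proof.
move=> /andP[r0 r1]; have w0 := ltW (weight_gt0 0).
apply: (@le_trans _ _ (weight 0 * \sum_(0 <= k < K) r ^+ k)).
  rewrite big_distrr/=; apply: ler_sum => k _.
  rewrite ler_pM ?exprn_ge0 ?weight_le0 ?(ltW (weight_gt0 k))//.
  by rewrite ler_wiXn2l ?leq_deg ?(ltW r1).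
rewrite ler_wpM2l// -[leRHS]mul1r ler_pdivlMr ?subr_gt0//.
have := subrX1 r K; rewrite big_mkord; have := exprn_ge0 K r0; lra.
Qed.

Lemma power_le_expRN (x : R) n : 0 <= x <= 1 -> (1 - x) ^+ n <= expR (- (n%:R * x)).
Proof.
move=> /andP[x0 x1]; rewrite -mulrN expRM_natl lerXn2r ?nnegrE ?expR_ge0 ?subr_ge0//.
exact: expR_ge1Dx.
Qed.

(** From (1 + a / 2)^2 <= exp a. *)
Lemma mul_expRN_le (a : R) : 0 < a -> a * expR (- a) <= 4 / a.
Proof.
move=> a0; rewrite expRN ler_pdivrMr ?expR_gt0// mulrAC ler_pdivlMr//.
have h : 1 + a / 2 <= expR (a / 2) by exact: expR_ge1Dx.
have -> : expR a = expR (a / 2) ^+ 2 by rewrite expr2 -expRD -splitr.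
have : (1 + a / 2) ^+ 2 <= expR (a / 2) ^+ 2.
  by rewrite lerXn2r ?nnegrE ?expR_ge0//; lra.
lra.
Qed.

Lemma one_powR (s : R) : 1 `^ s = 1.
Proof. by rewrite powR1. Qed.

(** The terms increase geometrically with ratio 2^eps up to the last nonzero
    one, which is at most 1. *)
Lemma sum_small_le (x eps : R) K : 0 < x -> 0 < eps ->
  \sum_(0 <= k < K) (if 2 ^+ k * x <= 1 then (2 ^+ k * x) `^ eps else 0)
    <= 2 `^ eps / (2 `^ eps - 1).
Proof.
move=> x0 eps0; set q := 2 `^ eps.
have q1 : 1 < q.
  by rewrite -[X in X < _](one_powR eps) gt0_ltr_powR ?nnegrE//; lra.
pose b k := (2 ^+ k * x) `^ eps.
have bS k : b k.+1 = q * b k.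
  by rewrite /b exprS -mulrA powRM ?mulr_ge0 ?exprn_ge0 ?(ltW x0).
have b0 k : 0 <= b k by exact: powR_ge0.
(* The first bound telescopes the geometric progression; the second one records
   that the progression has stopped. *)
suff [] : \sum_(0 <= k < K) (if 2 ^+ k * x <= 1 then b k else 0) <= b K / (q - 1)
  /\ \sum_(0 <= k < K) (if 2 ^+ k * x <= 1 then b k else 0) <= q / (q - 1) by [].
elim: K => [|K [IH1 IH2]].
  by rewrite big_geq//; split; apply: divr_ge0 => //; lra.
rewrite big_nat_recr//= bS; case: ifP => [h|_].
  have bK1 : b K <= 1.
    by rewrite -(one_powR eps) ge0_ler_powR ?nnegrE ?(ltW eps0) ?mulr_ge0 ?exprn_ge0 ?(ltW x0).
  have E : q * b K / (q - 1) = b K / (q - 1) + b K by field; rewrite subr_eq0 gt_eqF.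
  have : q * b K / (q - 1) <= q / (q - 1).
    by rewrite ler_pM2r ?invr_gt0 ?subr_gt0// ler_piMr//; lra.
  by rewrite E; split; lra.
rewrite addr0; split=> //; apply: le_trans IH1 _.
by rewrite ler_pM2r ?invr_gt0 ?subr_gt0// ler_peMl// ltW.
Qed.

(** The terms decrease geometrically with ratio 1/2 from the first nonzero
    one, which is at most 1. *)
Lemma sum_large_le (x : R) K : 0 < x ->
  \sum_(0 <= k < K) (if 2 ^+ k * x <= 1 then 0 else (2 ^+ k * x)^-1) <= 2.
Proof.
move=> x0; pose a k := 2 ^+ k * x; have a0 k : 0 < a k by rewrite mulr_gt0 ?exprn_gt0.
have aS k : a k.+1 = 2 * a k by rewrite /a exprS mulrA.
suff : \sum_(0 <= k < K) (if a k <= 1 then 0 else (a k)^-1) <= 2 - 2 * Num.min 1 (a K)^-1.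
  have : 0 <= Num.min 1 (a K)^-1 by rewrite le_min ler01 invr_ge0 ltW.
  by lra.
elim: K => [|K IH].
  have : Num.min 1 (a 0%N)^-1 <= 1 :> R by rewrite ge_min lexx.
  by rewrite big_geq//; lra.
rewrite big_nat_recr//=; have ai := a0 K; case: ifPn => [h|]; last first.
  rewrite -ltNge => h; move: IH.
  have i1 : (a K)^-1 <= 1 by rewrite invf_le1// ltW.
  have ip : 0 < (a K)^-1 by rewrite invr_gt0.
  rewrite (min_idPr i1) aS (invfM 2) => IH.
  have : Num.min 1 (2^-1 * (a K)^-1) <= 2^-1 * (a K)^-1 by rewrite ge_min lexx orbT.
  by lra.
have mE : Num.min 1 (a K)^-1 = 1 by apply/min_idPl; rewrite invf_ge1.
rewrite mE in IH.
have : Num.min 1 (a K.+1)^-1 <= 1 :> R by rewrite ge_min lexx.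
by move: IH; lra.
Qed.

Hypothesis omega_decr : exists2 eps : R, 0 < eps &
  forall s t : R, 0 < s -> s <= t -> t <= 1 ->
    omega t / t `^ (1 - eps) <= omega s / s `^ (1 - eps).

(** With a = 2^k (1 - r), the k-th term is at most omega(1 - r) / (1 - r) times
    a^eps if a <= 1, by the decrease of omega(t) / t^(1 - eps), and times a
    constant over a if a > 1, by the increase of omega and the exponential
    decay of r^deg.  Both bounds are geometric in k. *)
Lemma derivative_series_bounded : exists2 C : R, 0 < C & forall r K, 0 < r < 1 ->
  \sum_(0 <= k < K) (deg k)%:R * weight k * r ^+ deg k <=
    C * (omega (1 - r) / (1 - r)).
Proof.
have [eps eps0 hdec] := omega_decr.
have q1 : 1 < 2 `^ eps :> R.
  by rewrite -[X in X < _](one_powR eps) gt0_ltr_powR ?nnegrE//; lra.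
pose c1 := 2 `^ eps / (2 `^ eps - 1) : R; pose c2 := 4 * expR 1 : R.
have c10 : 0 < c1 by rewrite divr_gt0 ?subr_gt0//; lra.
have c20 : 0 < c2 by rewrite mulr_gt0 ?expR_gt0.
exists (c1 + c2 * 2); first by apply: addr_gt0 => //; apply: mulr_gt0.
move=> r K /andP[r0 r1]; pose x := 1 - r.
have x01 : 0 < x <= 1 by rewrite /x; lra.
have /andP[x0 x1] := x01; have wx := omega_gt0 x01.
have wxx : 0 < omega x / x by rewrite divr_gt0.
rewrite -/x.
pose a k := 2 ^+ k * x; have a0 k : 0 < a k by rewrite mulr_gt0 ?exprn_gt0.
have twoE k : 2 ^+ k = a k / x :> R by rewrite /a mulfK// gt_eqF.
have degle k : (deg k)%:R <= a k / x by rewrite deg_natr -twoE; lra.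
have rE : r = 1 - x by rewrite /x; ring.
have dya k : 2^-1 ^+ k = x / a k by rewrite /a invfM mulrCA mulfV ?mulr1 ?exprVn// gt_eqF.
have bound k : (deg k)%:R * weight k * r ^+ deg k <= omega x / x *
   ((if a k <= 1 then a k `^ eps else 0) + c2 * (if a k <= 1 then 0 else (a k)^-1)).
  have wk := weight_gt0 k; have /andP[d1 d2] := dyadic_itv k.
  case: ifPn => [ak1|]; rewrite ?mulr0 ?addr0 ?add0r.
    have wle : weight k <= omega x * a k `^ (eps - 1).
      have xt : x <= 2^-1 ^+ k.
        by rewrite dya ler_pdivlMr// ler_piMr// ltW.
      have := hdec _ _ x0 xt d2; rewrite -/(weight k).
      rewrite ler_pdivrMr ?powR_gt0// => h; apply: le_trans h _.
      rewrite dya powRM ?invr_ge0 ?(ltW x0) ?(ltW (a0 k))//.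
      have -> : (a k)^-1 `^ (1 - eps) = a k `^ (eps - 1).
        by rewrite -powR_inv1 ?(ltW (a0 k))// -powRrM mulN1r opprB.
      by rewrite -mulrA mulKf// gt_eqF// powR_gt0.
    apply: (@le_trans _ _ ((a k / x) * (omega x * a k `^ (eps - 1)) * 1)).
      apply: ler_pM; rewrite ?exprn_ge0 ?mulr_ge0 ?(ltW wk) ?(ltW r0)//.
        by rewrite ler_pM ?(ltW wk).
      by rewrite exprn_ile1 ?(ltW r0) ?(ltW r1).
    have -> : a k `^ eps = a k `^ (eps - 1) * a k.
      rewrite -[in LHS](subrK 1 eps) [LHS]powRD ?powRr1 ?(ltW (a0 k))//.
      by rewrite [X in _ ==> ~~ X]gt_eqF ?implybT.
    by rewrite le_eqVlt; apply/orP; left; apply/eqP; ring.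
  rewrite -ltNge => ak1.
  have wle : weight k <= omega x.
    apply: omega_incr => //; rewrite dya ler_pdivrMr// ler_peMr ?(ltW x0) ?(ltW ak1)//.
  have rle : r ^+ deg k <= expR 1 * expR (- a k).
    rewrite rE; apply: le_trans (power_le_expRN _ _) _; first by rewrite (ltW x0).
    by rewrite -expRD ler_expR deg_natr /a; lra.
  apply: (@le_trans _ _ ((a k / x * omega x) * (expR 1 * expR (- a k)))).
    apply: ler_pM; rewrite ?exprn_ge0 ?mulr_ge0 ?(ltW wk) ?(ltW r0)//.
    by rewrite ler_pM ?(ltW wk).
  have -> : a k / x * omega x * (expR 1 * expR (- a k)) =
    omega x / x * (expR 1 * (a k * expR (- a k))) by ring.
  apply: (@le_trans _ _ (omega x / x * (expR 1 * (4 / a k)))).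
    by rewrite ler_pM2l// ler_pM2l ?expR_gt0// mul_expRN_le.
  by rewrite /c2 le_eqVlt; apply/orP; left; apply/eqP; ring.
apply: (@le_trans _ _ (\sum_(0 <= k < K) (omega x / x *
   ((if a k <= 1 then a k `^ eps else 0) + c2 * (if a k <= 1 then 0 else (a k)^-1))))).
  by apply: ler_sum => k _; exact: bound.
rewrite -big_distrr/= mulrC ler_pM2r// big_split/= -big_distrr/=.
by rewrite lerD ?sum_small_le// ler_pM2l// sum_large_le.
Qed.

(** Monotone functions are measurable; omega is only monotone on (0, 1], so it
    is first precomposed with a truncation to [delta, 1]. *)
Lemma measurable_square_over (delta : R) : 0 < delta <= 1 ->
  measurable_fun (`[delta, 1] : set R) (fun t => omega t ^+ 2 / t).
Proof.
move=> /andP[d0 d1]; pose c t := Num.max delta (Num.min t 1).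
have cin t : delta <= c t <= 1.
  by rewrite /c le_max lexx/= ge_max d1/= ge_min lexx orbT.
have cmon s t : s <= t -> c s <= c t.
  move=> st; rewrite /c ge_max !le_max lexx/=; apply/orP; right.
  by rewrite le_min !ge_min st lexx !orbT.
apply: (eq_measurable_fun (fun t => omega (c t) ^+ 2 * (c t)^-1)).
  move=> t; rewrite inE/= in_itv/= => /andP[t1 t2].
  by rewrite /c (min_idPl t2) (max_idPr t1).
have mS := @measurable_itv R `[delta, 1].
apply: measurable_funM.
  apply: measurable_funX; apply: nondecreasing_measurable => // s t st.
  have /andP[h1 h2] := cin s; have /andP[h3 h4] := cin t.
  by apply: omega_incr; rewrite ?cmon// (lt_le_trans d0).
apply: nonincreasing_measurable => // s t st.
have /andP[h1 h2] := cin s; have /andP[h3 h4] := cin t.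
by rewrite lef_pV2 ?posrE ?cmon// (lt_le_trans d0).
Qed.

Lemma square_over_ge0 (t : R) : 0 < t -> 0 <= omega t ^+ 2 / t.
Proof. by move=> t0; rewrite divr_ge0 ?sqr_ge0// ltW. Qed.

Lemma integral_dyadic_le K :
  (\int[mu]_(t in `[(2^-1 ^+ K)%R, 1%R]) (omega t ^+ 2 / t)%:E <=
   (\sum_(0 <= k < K) weight k ^+ 2)%:E)%E.
Proof.
elim: K => [|K IH].
  by rewrite expr0 set_itv1 integral_set1 big_geq.
have /andP[a0 a1] := dyadic_itv K; have /andP[b0 b1] := dyadic_itv K.+1.
have ba : (2^-1 : R) ^+ K.+1 < 2^-1 ^+ K by rewrite exprS; lra.
have E : `[(2^-1 ^+ K.+1)%R, 1%R]%classic =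
    `[(2^-1 ^+ K.+1)%R, (2^-1 ^+ K)%R[%classic `|` `[(2^-1 ^+ K)%R, 1%R]%classic :> set R.
  by rewrite -itv_bndbnd_setU// bnd_simp ?(ltW ba).
have mf : measurable_fun (`[2^-1 ^+ K.+1, 1] : set R) (fun t => (omega t ^+ 2 / t)%:E).
  by apply/measurable_EFinP; apply: measurable_square_over; rewrite b0.
rewrite E ge0_integral_setU//=; last 3 first.
- by rewrite -E.
- move=> t [|] /=; rewrite in_itv/= => /andP[t1 _]; rewrite lee_fin square_over_ge0//.
    exact: lt_le_trans t1.
  exact: lt_le_trans t1.
- apply/disj_setPS => t [] /=; rewrite !in_itv/= => /andP[_ h1] /andP[h2 _].
  by rewrite (lt_geF h1) in h2.
rewrite big_nat_recr//= EFinD addeC; apply: leeD; last exact: IH.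
have -> : (weight K ^+ 2)%:E = (\int[mu]_(t in `[(2^-1 ^+ K.+1)%R, (2^-1 ^+ K)%R[)
    cst (weight K ^+ 2 * 2 ^+ K.+1)%:E t)%E.
  rewrite integral_cst//= lebesgue_measure_itv/= lte_fin ba -EFinB -EFinM.
  congr _%:E; rewrite !exprVn !(exprS 2); field.
  by rewrite expf_neq0.
apply: ge0_le_integral => //=.
- move=> t; rewrite in_itv/= => /andP[t1 _]; rewrite lee_fin square_over_ge0//.
  exact: lt_le_trans t1.
- apply: measurable_funS mf => // t /=; rewrite !in_itv/= => /andP[-> t2] /=.
  exact: le_trans (ltW t2) a1.
- move=> t; rewrite in_itv/= => /andP[t1 t2]; rewrite lee_fin.
  have t0 := lt_le_trans b0 t1.
  apply: ler_pM; rewrite ?sqr_ge0 ?invr_ge0 ?(ltW t0)//.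
    rewrite lerXn2r ?nnegrE ?(ltW (weight_gt0 _))//.
      by rewrite ltW// omega_gt0// t0 (le_trans (ltW t2)).
    by apply: omega_incr => //; exact: ltW.
  rewrite -[leRHS]invrK lef_pV2 ?posrE ?invr_gt0 ?exprn_gt0//.
  by rewrite -exprVn.
Qed.

Lemma integral_square_over_ge0 (x : R) : 0 < x ->
  (0 <= \int[mu]_(t in `[x, 1%R]) (omega t ^+ 2 / t)%:E)%E.
Proof.
move=> x0; apply: integral_ge0 => t /=; rewrite in_itv/= => /andP[xt _].
by rewrite lee_fin square_over_ge0// (lt_le_trans x0).
Qed.

Lemma Phi_ge1 (x : R) : 0 < x -> 1 <= Phi omega x.
Proof.
by move=> x0; rewrite /Phi /Rintegral lerDl fine_ge0 ?integral_square_over_ge0.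
Qed.

Lemma Phi_le_dyadic (x : R) K : 2^-1 ^+ K <= x -> x <= 1 ->
  Phi omega x <= 1 + \sum_(0 <= k < K) weight k ^+ 2.
Proof.
move=> Kx x1; have /andP[b0 b1] := dyadic_itv K; have x0 := lt_le_trans b0 Kx.
rewrite /Phi /Rintegral lerD2l.
have le1 : (\int[mu]_(t in `[x, 1%R]) (omega t ^+ 2 / t)%:E <=
    (\sum_(0 <= k < K) weight k ^+ 2)%:E)%E.
  apply: le_trans (integral_dyadic_le K); apply: ge0_subset_integral => //=.
  - by apply/measurable_EFinP; apply: measurable_square_over; rewrite b0.
  - move=> t; rewrite in_itv/= => /andP[t1 _]; rewrite lee_fin square_over_ge0//.
    exact: lt_le_trans t1.
  - by move=> t /=; rewrite !in_itv/= => /andP[xt ->]; rewrite (le_trans Kx xt).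
rewrite -lee_fin fineK// ge0_fin_numE ?integral_square_over_ge0//.
exact: le_lt_trans le1 (ltry _).
Qed.

(** With n = 2^k - 1 this is (1 + 1 / n)^n <= e. *)
Lemma power_deg_ge (r : R) k : 0 <= r -> 1 - 2^-1 ^+ k <= r \/ k = 0%N ->
  expR (-1) <= r ^+ deg k.
Proof.
move=> r0 [hr|->]; last by rewrite expr0 -[leRHS]expR0 ler_expR; lra.
have [d0|d0] := posnP (deg k); first by rewrite d0 expr0 -[leRHS]expR0 ler_expR; lra.
set n := deg k in d0 *; have nR : 0 < n%:R :> R by rewrite ltr0n.
have E : (2 : R) ^+ k = n%:R + 1 by rewrite /n deg_natr; ring.
have inv : (1 + n%:R^-1)^-1 <= r.
  apply: le_trans hr; rewrite exprVn E le_eqVlt; apply/orP; left; apply/eqP; field.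
  by rewrite !gt_eqF// addr_gt0.
have p0 : 0 < 1 + n%:R^-1 :> R by rewrite addr_gt0 ?invr_gt0.
apply: (@le_trans _ _ ((1 + n%:R^-1)^-1 ^+ n)); last first.
  by rewrite lerXn2r ?nnegrE ?invr_ge0 ?(ltW p0).
rewrite exprVn expRN lef_pV2 ?posrE ?expR_gt0 ?exprn_gt0//.
have -> : (1 : R) = n%:R * n%:R^-1 by rewrite mulfV// gt_eqF.
rewrite expRM_natl lerXn2r ?nnegrE ?expR_ge0 ?(ltW p0)// mulfV ?gt_eqF//.
exact: expR_ge1Dx.
Qed.

(** The levels k with 2^-k > 1 - r, which are those that matter for
    Phi(1 - r), are the ones on which r^deg is still bounded below.  Level 0
    takes care of the constant 1 in Phi. *)
Lemma Phi_le_level_sum : exists2 c : R, 0 < c & forall r, 0 <= r < 1 ->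
  exists K, c * Phi omega (1 - r) <= \sum_(0 <= k < K) (weight k * r ^+ deg k) ^+ 2.
Proof.
have w0 := weight_gt0 0; pose A := 1 + (weight 0 ^+ 2)^-1.
have A0 : 0 < A by rewrite addr_gt0 ?invr_gt0 ?exprn_gt0.
exists (expR (-1) ^+ 2 / A); first by rewrite divr_gt0 ?exprn_gt0 ?expR_gt0.
move=> r /andP[r0 r1]; have x0 : 0 < 1 - r by lra.
have exK : exists K, 2^-1 ^+ K <= 1 - r.
  exists (Num.truncn (1 - r)^-1).+1; rewrite exprVn -[leRHS]invrK.
  rewrite lef_pV2 ?posrE ?invr_gt0 ?exprn_gt0//; apply: ltW.
  apply: lt_le_trans (truncnS_gt _) _; rewrite -natrX ler_nat.
  exact: ltnW (ltn_expl _ _).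
have [K hK minK] := ex_minnP exK.
(* At least one level is kept, also when r = 0 and K = 0. *)
exists (maxn K 1).
have hPhi := Phi_le_dyadic hK (_ : 1 - r <= 1).
set S := \sum_(0 <= k < maxn K 1) weight k ^+ 2.
have SK : \sum_(0 <= k < K) weight k ^+ 2 <= S.
  rewrite /S [leRHS](big_cat_nat (n := K)) ?leq_maxl//= lerDl.
  by apply: sumr_ge0 => k _; exact: sqr_ge0.
have S0 : weight 0 ^+ 2 <= S.
  rewrite /S [leRHS](big_cat_nat (n := 1%N)) ?leq_maxr//= big_nat1 lerDl.
  by apply: sumr_ge0 => k _; exact: sqr_ge0.
have PhiS : Phi omega (1 - r) <= A * S.
  apply: le_trans (hPhi _) _; first by lra.
  rewrite /A mulrDl mul1r [leLHS]addrC lerD// mulrC ler_pdivlMr ?exprn_gt0//.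
  by rewrite mul1r.
apply: (@le_trans _ _ (expR (-1) ^+ 2 * S)).
  by rewrite mulrAC ler_pdivrMr// -[leRHS]mulrA [X in _ <= _ * X]mulrC ler_wpM2l ?sqr_ge0.
rewrite /S big_distrr/=; apply: ler_sum_nat => k /andP[_ kK].
rewrite exprMn [leRHS]mulrC ler_wpM2r ?sqr_ge0//.
rewrite lerXn2r ?nnegrE ?expR_ge0 ?exprn_ge0//; apply: power_deg_ge => //.
case: k kK => [|k] kK; [by right|left].
have kK' : (k.+1 < K)%N by move: kK; rewrite leq_max ltnS ltn0 orbF.
rewrite lerBlDr -lerBlDl leNgt; apply/negP => h.
have := minK k.+1; rewrite leqNgt kK' => /(_ _)/negP; apply=> //.
exact: ltW.
Qed.

End dyadic_sums.

(** * The random power series *)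

Section random_series.
Variables (R : realType) (d : nat) (W : nat -> R).
Hypothesis W0 : forall k, 0 <= W k.
Local Notation C := R[i].
Local Notation index := (nat * 'I_d * {ffun 'I_d -> nat})%type.
Implicit Types (z : 'rV[C]_d).

Definition exponent (a : nat) (j : 'I_d) : nat :=
  oapp (fun t : index => let: (k, i, m) := t in
    if admissible (deg k) i m then expo (deg k) i m j else 0%N) 0%N (pickle_inv a).

Definition coefficient (a : nat) : R :=
  oapp (fun t : index => let: (k, i, m) := t in
    if admissible (deg k) i m then W k * peak R (deg k) (expo (deg k) i m) else 0)
    0 (pickle_inv a).

Definition summand (a : nat) z : C :=
  (coefficient a)%:C * monomial (exponent a) z.

Lemma coefficient_ge0 a : 0 <= coefficient a.
Proof.
rewrite /coefficient; case: pickle_inv => [[[k i] m]|] //=.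
by case: ifP => // _; rewrite mulr_ge0 ?peak_ge0.
Qed.

Lemma flat_term_magnitude (x : 'I_d -> R) a :
  coefficient a * \prod_j x j ^+ exponent a j = flat (term W x) a.
Proof.
rewrite /flat /coefficient /exponent.
case: pickle_inv => [[[k i] m]|] /=; last by rewrite mul0r.
by case: ifP => _ /=; rewrite ?mul0r// mulrA.
Qed.

Lemma flat_term_degree (x : 'I_d -> R) a :
  (\sum_j exponent a j)%:R * flat (term W x) a =
  flat (term (fun k => (deg k)%:R * W k) x) a.
Proof.
rewrite /flat /exponent.
case: pickle_inv => [[[k i] m]|] /=; last by rewrite mulr0.
case: ifP => adm /=; last by rewrite mulr0.
by rewrite (sum_expo adm) mulrA.
Qed.

Lemma cmod_summand a z :
  cmod (summand a z) = flat (term W (fun j => cmod (z 0 j))) a.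
Proof.
rewrite -flat_term_magnitude cmodM cmod_real ger0_norm ?coefficient_ge0//.
by congr (_ * _); rewrite cmod_prod; apply: eq_bigr => j _; rewrite cmodX.
Qed.

Definition random_sum (y : R) z : C := rsum (summand^~ z) y.

Lemma enorm_ge0 z : 0 <= enorm z.
Proof. exact: sqrtr_ge0. Qed.

Lemma sqr_enorm z : \sum_j cmod (z 0 j) ^+ 2 = enorm z ^+ 2.
Proof. by rewrite sqr_sqrtr// sumr_ge0// => j _; exact: sqr_ge0. Qed.

Lemma cmod_le_enorm z j : cmod (z 0 j) <= enorm z.
Proof.
rewrite -(ler_pXn2r (_ : 0 < 2)%N) ?nnegrE ?cmod_ge0 ?enorm_ge0// -sqr_enorm.
by rewrite (bigD1 j)//= lerDl; apply: sumr_ge0 => i _; exact: sqr_ge0.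
Qed.

(** A closed polydisc around z still lies in a ball of radius r < 1: each
    coordinate contributes 2 rho |z_j| + rho^2 <= 3 rho, and 3 d rho is the gap
    between the squared radii. *)
Lemma polyradius z : (0 < d)%N -> enorm z < 1 -> exists rho r : R,
  [/\ 0 < rho, 0 < r < 1 & \sum_j (cmod (z 0 j) + rho) ^+ 2 <= r ^+ 2].
Proof.
move=> d0 z1; have z0 := enorm_ge0 z; set s := enorm z in z0 z1.
have dR : 1 <= d%:R :> R by rewrite ler1n.
pose r := (1 + s) / 2; pose rho := (r ^+ 2 - s ^+ 2) / (3 * d%:R).
have d3 : 0 < 3 * d%:R :> R by lra.
have rs : 0 < r ^+ 2 - s ^+ 2.
  have -> : r ^+ 2 - s ^+ 2 = (r - s) * (r + s) by ring.
  by rewrite mulr_gt0// /r; lra.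
have r1 : r ^+ 2 < 1 by rewrite expr_lt1// /r; lra.
have rho0 : 0 < rho by rewrite divr_gt0.
have rho1 : rho <= 1.
  by rewrite ler_pdivrMr// mul1r; have := sqr_ge0 s; lra.
exists rho, r; split=> //; first by rewrite /r; lra.
have -> : r ^+ 2 = s ^+ 2 + d%:R * (3 * rho).
  by rewrite /rho; field; rewrite gt_eqF//; lra.
rewrite -sqr_enorm mulr_natl -[X in _ *+ X]card_ord -sumr_const -big_split/=.
apply: ler_sum => j _; have := cmod_ge0 (z 0 j); have := cmod_le_enorm z j.
rewrite -/s; move: (cmod _) => c c1 c0.
have : c * rho <= rho by rewrite ler_piMl ?(ltW rho0)//; lra.
have : rho * rho <= rho by rewrite ler_piMl// ltW.
lra.
Qed.

Lemma summand_abs_bounded z (r B : R) : 0 < r ->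
  \sum_j cmod (z 0 j) ^+ 2 <= r ^+ 2 ->
  (forall K, \sum_(0 <= k < K) W k * r ^+ deg k <= B) ->
  abs_bounded (summand^~ z) (family_bound R d * B).
Proof.
move=> r0 zr hB N; under eq_bigr do rewrite cmod_summand.
by apply: flat_term_le hB => // j; exact: cmod_ge0.
Qed.

Lemma degree_abs_bounded z (r B : R) : 0 < r ->
  \sum_j cmod (z 0 j) ^+ 2 <= r ^+ 2 ->
  (forall K, \sum_(0 <= k < K) (deg k)%:R * W k * r ^+ deg k <= B) ->
  abs_bounded (fun a => (\sum_j exponent a j)%:R * summand a z) (family_bound R d * B).
Proof.
move=> r0 zr hB N; have E a : cmod ((\sum_j exponent a j)%:R * summand a z) =
    flat (term (fun k => (deg k)%:R * W k) (fun j => cmod (z 0 j))) a.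
  rewrite cmodM cmod_summand -flat_term_degree; congr (_ * _).
  have -> : (\sum_j exponent a j)%:R = ((\sum_j exponent a j)%:R)%:C :> C.
    by rewrite rmorph_nat.
  by rewrite cmod_real ger0_norm.
under eq_bigr do rewrite E.
apply: (flat_term_le _ _ r0 _ zr hB) => [k|j]; last exact: cmod_ge0.
by rewrite mulr_ge0.
Qed.

Hypothesis W_sum : forall r : R, 0 < r < 1 ->
  exists B, forall K, \sum_(0 <= k < K) W k * r ^+ deg k <= B.
Hypothesis W_deg_sum : forall r : R, 0 < r < 1 ->
  exists B, forall K, \sum_(0 <= k < K) (deg k)%:R * W k * r ^+ deg k <= B.

(** Differentiability needs no cancellation among the signs: the majorants are
    those of the series with all terms positive, at the shifted point. *)
Lemma random_sum_differentiable y z : (0 < d)%N -> enorm z < 1 ->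
  differentiable (random_sum y) z /\
  radial_derivative (random_sum y) z =
    rsum (fun a => (\sum_j exponent a j)%:R * summand a z) y.
Proof.
move=> d0 z1; have [rho [r [rho0 r01 zr]]] := polyradius d0 z1.
have [B hB] := W_sum r01; have [B' hB'] := W_deg_sum r01.
have /andP[r0 r1] := r01.
have zr' : \sum_j cmod (z 0 j) ^+ 2 <= r ^+ 2.
  apply: le_trans zr; apply: ler_sum => j _.
  by rewrite lerXn2r ?nnegrE ?cmod_ge0 ?addr_ge0 ?cmod_ge0 ?(ltW rho0)// lerDl ltW.
pose v a w : C := (rad a y)%:C * summand a w.
have tv a : exists D, taylor_at rho z (v a) (\sum_j exponent a j)
    (flat (term W (fun j => cmod (z 0 j) + rho)) a) D.
  have := taylor_monomial z (exponent a) (rad a y * coefficient a)%:C (ltW rho0).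
  rewrite cmod_real normrM norm_rad mul1r ger0_norm ?coefficient_ge0//.
  rewrite flat_term_magnitude /v /summand.
  rewrite (_ : (fun w => (rad a y * coefficient a)%:C * monomial (exponent a) w) =
    (fun w => (rad a y)%:C * ((coefficient a)%:C * monomial (exponent a) w)))//.
  by apply/funext => w; rewrite rmorphM mulrA.
have bv : abs_bounded (fun a => (\sum_j exponent a j)%:R * v a z) (family_bound R d * B').
  apply: abs_bounded_le (degree_abs_bounded r0 zr' hB') => a.
  by rewrite /v mulrCA cmod_rad.
have bM N : \sum_(0 <= a < N) flat (term W (fun j => cmod (z 0 j) + rho)) a <=
    family_bound R d * B.
  by apply: flat_term_le hB => // j; rewrite addr_ge0 ?cmod_ge0 ?(ltW rho0).
have [df dE] := csum_differentiable rho0 tv bM bv.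
rewrite [radial_derivative _ _]dE.
split; first exact: df.
by rewrite /rsum; congr csum; apply/funext => a; rewrite /v mulrCA.
Qed.

End random_series.

(** * Random power series in the weighted Bloch space *)

Theorem theorem1p2 (R : realType) (d : nat) (hd : (0 < d)%N)
    (p : R) (hp : 0 < p) (omega : R -> R)
    (omega_gt0 : forall t : R, 0 < t <= 1 -> 0 < omega t)
    (omega_incr : forall s t : R, 0 < s -> s <= t -> t <= 1 ->
      omega s <= omega t)
    (omega_decr : exists2 eps : R, 0 < eps &
      forall s t : R, 0 < s -> s <= t -> t <= 1 ->
        omega t / t `^ (1 - eps) <= omega s / s `^ (1 - eps)) :
  exists tau : R, 0 < tau /\
  exists F : R -> 'rV[R[i]]_d -> R[i],
    (forall y : R, 0 <= y <= 1 ->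
       weighted_bloch omega (F y) /\ (bloch_norm omega (F y) <= 1)%E) /\
    (forall z : 'rV[R[i]]_d, unit_ball z ->
       measurable_fun (`[0%R, 1%R] : set R) (fun y : R => cmod (F y z) `^ (2 * p)) /\
       ((tau * Phi omega (1 - enorm z) `^ p)%:E <=
        \int[lebesgue_measure]_(y in `[0%R, 1%R])
           (cmod (F y z) `^ (2 * p))%:E)%E).
Proof.
have w_gt0 := weight_gt0 omega_gt0.
have [C C0 hC] := derivative_series_bounded omega_gt0 omega_incr omega_decr.
have [c c0 hc] := Phi_le_level_sum omega_gt0 omega_incr.
pose A := family_bound R d.
have A0 : 0 < A.
  rewrite mulr_gt0 ?ltr0n// exprn_gt0//.
  exact: lt_le_trans ltr01 (@gauss_bound_ge1 R).
pose w := weight omega 0.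
have w0 : 0 < w := w_gt0 0%N.
(* T is the sum of the unnormalised bounds for |F_y(0)| and for the supremum in
   the norm. *)
pose T := 2 * (A * C) + 4 * (A * w).
have T0 : 0 < T.
  by have := mulr_gt0 A0 C0; have := mulr_gt0 A0 w0; rewrite /T; lra.
pose kappa := T^-1; have k0 : 0 < kappa by rewrite invr_gt0.
pose W k := kappa * weight omega k.
have W0 k : 0 <= W k by rewrite mulr_ge0 ?(ltW k0) ?(ltW (w_gt0 k)).
have Wsum (r : R) K : 0 <= r < 1 ->
    \sum_(0 <= k < K) W k * r ^+ deg k <= kappa * (w / (1 - r)).
  move=> r01; under eq_bigr do rewrite -mulrA; rewrite -big_distrr/=.
  by rewrite ler_wpM2l ?(ltW k0)// level_series_bounded.
have Wdeg (r : R) K : 0 < r < 1 -> \sum_(0 <= k < K) (deg k)%:R * W k * r ^+ deg k <=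
    kappa * (C * (omega (1 - r) / (1 - r))).
  move=> r01; apply: le_trans (ler_wpM2l (ltW k0) (hC _ K r01)).
  rewrite big_distrr/=; apply: ler_sum => k _.
  by rewrite /W mulrCA -!mulrA.
have hW1 r : 0 < r < 1 -> exists B, forall K, \sum_(0 <= k < K) W k * r ^+ deg k <= B.
  move=> /andP[r0 r1]; exists (kappa * (w / (1 - r))) => K.
  by apply: Wsum; rewrite (ltW r0).
have hW2 r : 0 < r < 1 ->
    exists B, forall K, \sum_(0 <= k < K) (deg k)%:R * W k * r ^+ deg k <= B.
  by move=> r01; eexists => K; exact: Wdeg.
have zr (z : 'rV[R[i]]_d) (r : R) : enorm z <= r -> \sum_j cmod (z 0 j) ^+ 2 <= r ^+ 2.
  move=> h; rewrite sqr_enorm lerXn2r ?nnegrE ?enorm_ge0//.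
  exact: le_trans (enorm_ge0 _) h.
pose L := peak_loss R d * kappa ^+ 2 * c.
have L0 : 0 < L by rewrite !mulr_gt0 ?expR_gt0 ?exprn_gt0.
exists ((L / 16) `^ p / 12); split.
  by rewrite divr_gt0// powR_gt0// divr_gt0.
exists (@random_sum R d W); split.
- move=> y _.
  have F0 : cmod (random_sum W y (0 : 'rV[R[i]]_d)) <= 4 * (A * w) * kappa.
    (* The origin lies in every ball; radius 1/2 keeps 1 - r away from 0. *)
    have half : 0 < (2^-1 : R) < 1 by lra.
    have z0 : enorm (0 : 'rV[R[i]]_d) <= 2^-1.
      rewrite /enorm big1 ?sqrtr0; first by lra.
      by move=> j _; rewrite mxE cmod0 expr0n.
    have hb K : \sum_(0 <= k < K) W k * 2^-1 ^+ deg k <= kappa * (w / (1 - 2^-1)).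
      by apply: Wsum; lra.
    have h := summand_abs_bounded W0 (_ : 0 < 2^-1) (zr _ _ z0) hb.
    have hr : abs_bounded (fun a => (rad a y)%:C * summand W a (0 : 'rV[R[i]]_d))
        (A * (kappa * (w / (1 - 2^-1)))).
      by apply: abs_bounded_le (h _) => [a|]; [rewrite cmod_rad|lra].
    apply: le_trans (cmod_csum_le hr) _.
    by rewrite le_eqVlt; apply/orP; left; apply/eqP; field.
  have Rf (z : 'rV[R[i]]_d) : enorm z < 1 -> cmod (radial_derivative (random_sum W y) z) *
      (1 - enorm z) / omega (1 - enorm z) <= 2 * (A * C) * kappa.
    move=> z1; have := enorm_ge0 z; rewrite le_eqVlt => /predU1P[z0|z0].
      rewrite /radial_derivative big1 => [|j _].
        by rewrite cmod0 !mul0r ltW// mulr_gt0// mulr_gt0// mulr_gt0.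
      have cz : cmod (z 0 j) = 0.
        by apply/le_anti; rewrite cmod_ge0 andbT (le_trans (cmod_le_enorm z j))// -z0.
      by rewrite (ComplexField.Normc.eq0_normc cz) mul0r.
    have [_ ->] := random_sum_differentiable W0 hW1 hW2 y hd z1.
    have r01 : 0 < enorm z < 1 by rewrite z0.
    have h := degree_abs_bounded W0 z0 (zr _ _ (lexx _)) (fun K => Wdeg _ K r01).
    set v := fun a => _ * _ in h.
    have hr : abs_bounded (fun a => (rad a y)%:C * v a)
        (A * (kappa * (C * (omega (1 - enorm z) / (1 - enorm z))))).
      by apply: abs_bounded_le h => a; rewrite cmod_rad.
    have := cmod_csum_le hr; rewrite -/(rsum v y) => hs.
    have x0 : 0 < 1 - enorm z by lra.
    have wx : 0 < omega (1 - enorm z) by apply: omega_gt0; lra.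
    rewrite ler_pdivrMr// -ler_pdivlMr//; apply: le_trans hs _.
    by rewrite le_eqVlt; apply/orP; left; apply/eqP; ring.
  have norm1 : (bloch_norm omega (@random_sum R d W y) <= 1)%E.
    rewrite /bloch_norm.
    apply: (@le_trans _ _ ((4 * (A * w) * kappa)%:E + (2 * (A * C) * kappa)%:E)%E).
      apply: leeD; first by rewrite lee_fin.
      by apply: ge_ereal_sup => _ [z z1 <-]; rewrite lee_fin Rf.
    by rewrite -EFinD lee_fin -mulrDl addrC -/T mulfV// gt_eqF.
  split=> //; split; last by apply: le_lt_trans norm1 (ltry _).
  by move=> z z1; have [] := random_sum_differentiable W0 hW1 hW2 y hd z1.
- move=> z z1; have z0 := enorm_ge0 z; set r := enorm z.
  have r01 : 0 <= r < 1 by rewrite z0.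
  have x0 : 0 < 1 - r by rewrite subr_gt0.
  have [rho [s [rho0 /andP[s0 s1] zs]]] := polyradius hd z1.
  have bz : abs_bounded (fun a => summand W a z) (A * (kappa * (w / (1 - s)))).
    apply: (summand_abs_bounded W0 s0); last by move=> K; apply: Wsum; rewrite (ltW s0).
    apply: le_trans zs; apply: ler_sum => j _.
    by rewrite lerXn2r ?nnegrE ?cmod_ge0 ?addr_ge0 ?cmod_ge0 ?(ltW rho0)// lerDl ltW.
  split; first exact: measurable_rsum bz.
  have P1 := Phi_ge1 omega x0.
  (* S bounds the sum of the squared moduli from below; Khinchine's inequality
     carries its p-th power over to the integral. *)
  pose S := L * Phi omega (1 - r).
  have S0 : 0 < S by rewrite mulr_gt0// (lt_le_trans ltr01).
  have [K hK] := hc r r01.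
  have [N hN] := flat_term_ge K hd W0 z0 (fun j => cmod_ge0 (z 0 j)) (sqr_enorm z).
  have SN : S <= \sum_(0 <= a < N) cmod (summand W a z) ^+ 2.
    under eq_bigr do rewrite cmod_summand//.
    apply: le_trans hN.
    have -> : \sum_(0 <= k < K) (W k * enorm z ^+ deg k) ^+ 2 =
        kappa ^+ 2 * \sum_(0 <= k < K) (weight omega k * r ^+ deg k) ^+ 2.
      by rewrite big_distrr/=; apply: eq_bigr => k _; rewrite /W -mulrA exprMn.
    have -> : S = peak_loss R d * (kappa ^+ 2 * (c * Phi omega (1 - r))).
      by rewrite /S /L -!mulrA.
    by rewrite ler_wpM2l ?expR_ge0// ler_wpM2l ?sqr_ge0.
  have := khinchine_lower bz hp S0 SN; apply: le_trans; rewrite lee_fin.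
  have -> : S / 16 = L / 16 * Phi omega (1 - r) by rewrite /S mulrAC.
  have L16 : 0 <= L / 16 by rewrite divr_ge0// ltW.
  by rewrite (powRM p L16 (le_trans ler01 P1)) mulrAC.
Qed.
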